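(* Let $f$ satisfy (f1) and suppose $f_0\in(0,+\infty)$ and $f_\infty\in(0,+\infty)$. Then for every $\lambda$ in the open interval with endpoints $\lambda_1/f_\infty$ and $\lambda_1/f_0$ (i.e. $\lambda\in(\lambda_1/f_\infty,\lambda_1/f_0)$ or $\lambda\in(\lambda_1/f_0,\lambda_1/f_\infty)$), problem (MO) has two solutions $u^+$ and $u^-$ such that $u^+$ is positive and strictly concave in $(0,1)$ and $u^-$ is negative and strictly convex in $(0,1)$.
   Context: Let $N\ge 1$ be an integer and $f:\mathbb{R}\to\mathbb{R}$ continuous. For $\lambda\ge 0$, problem (MO) is: find $u\in C^2[0,1]$ with $\left((u'(r))^N\right)'=\lambda^N N r^{N-1} f(-u(r))$ for $0<r<1$ and $u'(0)=u(1)=0$. Condition (f1): $f\in C(\mathbb{R},\mathbb{R})$ and $f(s)s^N>0$ for all $s\neq0$. The quantities $f_0,f_\infty\in[0,+\infty]$ are defined by $f_0^N=\lim_{s\to0} f(s)/s^N$ and $f_\infty^N=\lim_{|s|\to+\infty} f(s)/s^N$ (these limits are assumed to exist in $[0,+\infty]$; $f_0=\infty$ means the limit is $+\infty$, etc.). $\lambda_1>0$ denotes the first eigenvalue of the problem $\left((-v')^N\right)'=\lambda^N N r^{N-1}v^N$ in $(0,1)$, $v'(0)=v(1)=0$, i.e. the unique $\lambda>0$ for which this problem has a solution $v\in C^2[0,1]$ positive in $(0,1)$ (this eigenvalue is simple). *)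

(* Defs.v *)
From Stdlib Require Import Reals Lra.
Open Scope R_scope.

(* g has derivative g' at every point of [a,b], derivatives at the endpoints
   being one-sided (difference quotients taken within [a,b]). *)
Definition has_deriv_on (g g' : R -> R) (a b : R) : Prop :=
  forall x, a <= x <= b ->
    forall eps, 0 < eps -> exists delta, 0 < delta /\
      forall y, a <= y <= b -> y <> x -> Rabs (y - x) < delta ->
        Rabs ((g y - g x) / (y - x) - g' x) < eps.

Definition continuous_on (g : R -> R) (a b : R) : Prop :=
  forall x, a <= x <= b ->
    forall eps, 0 < eps -> exists delta, 0 < delta /\
      forall y, a <= y <= b -> Rabs (y - x) < delta -> Rabs (g y - g x) < eps.

Definition C2_01 (u u1 u2 : R -> R) : Prop :=
  has_deriv_on u u1 0 1 /\ has_deriv_on u1 u2 0 1 /\ continuous_on u2 0 1.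

Definition cond_f1 (N : nat) (f : R -> R) : Prop :=
  continuity f /\ forall s, s <> 0 -> f s * s ^ N > 0.

Definition is_f0 (N : nat) (f : R -> R) (f0 : R) : Prop :=
  forall eps, 0 < eps -> exists delta, 0 < delta /\
    forall s, s <> 0 -> Rabs s < delta -> Rabs (f s / s ^ N - f0 ^ N) < eps.

Definition is_finf (N : nat) (f : R -> R) (finf : R) : Prop :=
  forall eps, 0 < eps -> exists M, 0 < M /\
    forall s, M < Rabs s -> Rabs (f s / s ^ N - finf ^ N) < eps.

Definition solves_MO (N : nat) (f : R -> R) (lam : R) (u : R -> R) : Prop :=
  exists u1 u2 : R -> R,
    C2_01 u u1 u2 /\
    (forall r, 0 < r < 1 ->
       derivable_pt_lim (fun x => (u1 x) ^ N) r
         (lam ^ N * INR N * r ^ (N - 1) * f (- u r))) /\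
    u1 0 = 0 /\ u 1 = 0.

Definition pos_eigenfunction (N : nat) (lam : R) (v : R -> R) : Prop :=
  exists v1 v2 : R -> R,
    C2_01 v v1 v2 /\
    (forall r, 0 < r < 1 ->
       derivable_pt_lim (fun x => (- v1 x) ^ N) r
         (lam ^ N * INR N * r ^ (N - 1) * (v r) ^ N)) /\
    v1 0 = 0 /\ v 1 = 0 /\
    (forall r, 0 < r < 1 -> 0 < v r).

Definition first_eigenvalue (N : nat) (lam1 : R) : Prop :=
  0 < lam1 /\ (exists v, pos_eigenfunction N lam1 v) /\
  (forall lam, 0 < lam -> (exists v, pos_eigenfunction N lam v) -> lam = lam1).

Definition strictly_concave_01 (u : R -> R) : Prop :=
  forall x y t, 0 < x < 1 -> 0 < y < 1 -> x <> y -> 0 < t < 1 ->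
    u (t * x + (1 - t) * y) > t * u x + (1 - t) * u y.

Definition strictly_convex_01 (u : R -> R) : Prop :=
  forall x y t, 0 < x < 1 -> 0 < y < 1 -> x <> y -> 0 < t < 1 ->
    u (t * x + (1 - t) * y) < t * u x + (1 - t) * u y.

(* Main.v *)
(* After the substitutions w = u and w = -u both solutions come from one radial problem
   w(r) = d - lam * int_0^r (int_0^t N s^(N-1) g(w(s)) ds)^(1/N) dt, w(1) = 0, with g > 0
   on (0, oo), and the free datum is d = w(0).  For d near 0 or near oo the nonlinearity
   g is, up to an error eta * d^N on [0, d], the power (phi s)^N with phi = f0 or finf.
   Comparing w with the first eigenfunction V then gives the sign of w(1): if
   lam * phi < lam1 and w(1) <= 0, any bound w <= c V self-improves to w <= theta c V with
   a fixed theta < 1, which is absurd; dually w(1) < 0 if lam * phi > lam1.  So w(1)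
   changes sign between a small and a large d.  Since g is only continuous the initial
   value problem need not have a unique solution, so the intermediate value theorem is
   applied to Tonelli's delayed approximations, which depend continuously on d, and the
   solution is their limit along an ultrafilter. *)

Require Import Defs.
From mathcomp Require boolp filter.
From Stdlib Require Import Reals Lra Lia Classical.
From Coquelicot Require Import Coquelicot.
Open Scope R_scope.

(** Without uniqueness, the comparison has to hold for every solution with a given datum: whichever
    one the approximations select, its sign at 1 is then known. The error is measured by
    [eta * d ^ N], relative to the datum and not to [s ^ N]: near infinity nothing is known of the
    quotient g(s) / s^N at moderate s, but such s contribute a bounded error, small against d^N. It
    is absorbed because the weighted integral of V^N over [0,t] is at least kappa * t^N, the same
    order at the origin as the integral of a constant. Moreover [eta] depends neither on the
    nonlinearity nor on d, so g may be truncated at the large datum afterwards; truncation supplies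
    the boundedness and uniform continuity that the delayed scheme needs, and a solution with values
    in [0,d] does not see it. Two further obstacles come from the N-th root. For even N the
    eigenvalue equation fixes V' only up to sign. For N > 1 the root is not differentiable at 0,
    exactly where the inner integral vanishes, so second-order regularity at r = 0 needs its own
    argument. *)

(** * The N-th root, extended by zero to the negative half-line *)

Definition root (N : nat) (x : R) : R :=
  if Rle_dec x 0 then 0 else Rpower x (/ INR N).

Lemma root_nonneg N x : 0 <= root N x.
Proof.
  unfold root; destruct (Rle_dec x 0); [lra | left; apply exp_pos].
Qed.

Lemma root_npos N x : x <= 0 -> root N x = 0.
Proof. intros H; unfold root; destruct (Rle_dec x 0); lra. Qed.

Lemma root_gt0 N x : 0 < x -> 0 < root N x.
Proof.
  intros H; unfold root; destruct (Rle_dec x 0); [lra | apply exp_pos].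
Qed.

Lemma root_pow N x : (1 <= N)%nat -> 0 <= x -> root N x ^ N = x.
Proof.
  intros HN Hx; unfold root; destruct (Rle_dec x 0).
  - rewrite pow_i by lia; lra.
  - rewrite <- Rpower_pow by apply exp_pos.
    rewrite Rpower_mult, Rinv_l, Rpower_1; [reflexivity | lra |].
    apply not_0_INR; lia.
Qed.

Lemma pow_lt_compat N x y : (1 <= N)%nat -> 0 <= x < y -> x ^ N < y ^ N.
Proof.
  intros HN Hxy; induction HN as [|n Hn IH]; [simpl; lra |].
  assert (0 <= x ^ n) by (apply pow_le; lra).
  simpl; nra.
Qed.

Lemma pow_le_reg N x y : 0 <= x -> 0 <= y -> (1 <= N)%nat -> x ^ N <= y ^ N -> x <= y.
Proof.
  intros Hx Hy HN H; destruct (Rle_lt_dec x y) as [|Hlt]; [assumption |].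
  exfalso; apply (Rlt_irrefl (y ^ N)), Rlt_le_trans with (x ^ N); [| assumption].
  apply pow_lt_compat; [assumption | lra].
Qed.

Lemma pow_root N y : (1 <= N)%nat -> 0 <= y -> root N (y ^ N) = y.
Proof.
  intros HN Hy; assert (H : 0 <= y ^ N) by (apply pow_le; assumption).
  assert (E := root_pow N (y ^ N) HN H); assert (P := root_nonneg N (y ^ N)).
  apply Rle_antisym; apply pow_le_reg with N; auto; lra.
Qed.

Lemma root_le N x y : (1 <= N)%nat -> x <= y -> root N x <= root N y.
Proof.
  intros HN H; destruct (Rle_lt_dec x 0) as [Hx | Hx].
  - rewrite root_npos by assumption; apply root_nonneg.
  - apply pow_le_reg with N; auto using root_nonneg.
    rewrite !root_pow by (auto; lra); assumption.
Qed.

Lemma root_scal N c x : (1 <= N)%nat -> 0 <= c -> 0 <= x ->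
  root N (c ^ N * x) = c * root N x.
Proof.
  intros HN Hc Hx.
  rewrite <- (root_pow N x HN Hx) at 1; rewrite <- Rpow_mult_distr.
  apply pow_root; [assumption |].
  apply Rmult_le_pos; auto using root_nonneg.
Qed.

Lemma pow_superadd N a b : (1 <= N)%nat -> 0 <= a -> 0 <= b ->
  a ^ N + b ^ N <= (a + b) ^ N.
Proof.
  intros HN Ha Hb; induction HN as [|n Hn IH]; [simpl; lra |].
  assert (0 <= a ^ n) by (apply pow_le; assumption).
  assert (0 <= b ^ n) by (apply pow_le; assumption).
  simpl; nra.
Qed.

(** Superadditivity of the power on nonnegative numbers turns into subadditivity of the root. *)
Lemma root_add_le N x e : (1 <= N)%nat -> 0 <= e ->
  root N (x + e ^ N) <= root N x + e.
Proof.
  intros HN He; assert (P := root_nonneg N x).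
  assert (0 <= e ^ N) by (apply pow_le; assumption).
  destruct (Rle_lt_dec x 0) as [Hx | Hx].
  - rewrite (root_npos N x), Rplus_0_l by assumption.
    apply Rle_trans with (root N (e ^ N)); [apply root_le; [assumption | lra] |].
    rewrite pow_root by assumption; lra.
  - apply pow_le_reg with N; auto using root_nonneg; [lra |].
    rewrite root_pow by (auto; lra).
    apply Rle_trans with (2 := pow_superadd N (root N x) e HN P He).
    rewrite root_pow by (auto; lra); lra.
Qed.

(** Hoelder continuity with exponent 1/N and constant 1, valid on the whole line thanks to the
    cut-off at 0. It is the reason why later estimates ask for closeness [e ^ N] inside an integral
    in order to obtain [e] outside. *)
Lemma root_unif N x y e : (1 <= N)%nat -> 0 <= e -> Rabs (x - y) <= e ^ N ->
  Rabs (root N x - root N y) <= e.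
Proof.
  intros HN He H; apply Rabs_le_between in H.
  assert (A := root_add_le N x e HN He); assert (B := root_add_le N y e HN He).
  assert (root N y <= root N (x + e ^ N)) by (apply root_le; [assumption | lra]).
  assert (root N x <= root N (y + e ^ N)) by (apply root_le; [assumption | lra]).
  apply Rabs_le; lra.
Qed.

Lemma root_continuous N x : (1 <= N)%nat -> continuous (root N) x.
Proof.
  intros HN; apply continuity_pt_filterlim, continuity_pt_locally; intros [e He].
  assert (He' : 0 < (e / 2) ^ N) by (apply pow_lt; lra).
  exists (mkposreal _ He'); intros y Hy; simpl in *.
  apply Rle_lt_trans with (e / 2); [| lra].
  apply root_unif; [assumption | lra | left; exact Hy].
Qed.

Lemma root_derive N x : (1 <= N)%nat -> 0 < x ->
  is_derive (root N) x (/ (INR N * root N x ^ (N - 1))).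
Proof.
  intros HN Hx.
  apply is_derive_ext_loc with (fun x => Rpower x (/ INR N)).
  - exists (mkposreal x Hx); intros y Hy; simpl in *.
    apply Rabs_lt_between in Hy; unfold minus, plus, opp in Hy; simpl in Hy.
    unfold root; destruct (Rle_dec y 0); [lra | reflexivity].
  - assert (H0 : INR N <> 0) by (apply not_0_INR; lia).
    replace (/ (INR N * root N x ^ (N - 1)))
      with (/ INR N * Rpower x (/ INR N - 1)).
    + apply is_derive_Reals, derivable_pt_lim_power; assumption.
    + rewrite Rinv_mult; f_equal.
      unfold root; destruct (Rle_dec x 0); [lra |].
      rewrite <- Rpower_pow by apply exp_pos.
      rewrite Rpower_mult, <- Rpower_Ropp; f_equal.
      rewrite minus_INR by assumption; simpl; field; assumption.
Qed.

(** * Radial integral operators *)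

(** If [h] is the right-hand side and w'(0) = 0, then [lam ^ N * wint N h t] is (-w'(t))^N, and
    [lam * rint N h r] below is w(0) - w(r). The weight has mass [t ^ N] on [0,t], which makes
    [wint] of a constant explicit. *)
Definition wint (N : nat) (h : R -> R) (t : R) : R :=
  RInt (fun s => INR N * s ^ (N - 1) * h s) 0 t.

Definition rint (N : nat) (h : R -> R) (r : R) : R :=
  RInt (fun t => root N (wint N h t)) 0 r.

Definition cont (h : R -> R) : Prop := forall x, continuous h x.

Lemma cont_ex_RInt h a b : cont h -> ex_RInt h a b.
Proof. intros H; apply @ex_RInt_continuous; intros; apply H. Qed.

Lemma cont_RInt_derive h a x : cont h -> is_derive (RInt h a) x (h x).
Proof.
  intros H; apply is_derive_RInt with a; [| apply H].
  apply filter_forall; intros y; apply RInt_correct, cont_ex_RInt, H.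
Qed.

Lemma is_derive_cont h dh : (forall x, is_derive h x (dh x)) -> cont h.
Proof. intros H x; apply @ex_derive_continuous; exists (dh x); apply H. Qed.

Lemma cont_const c : cont (fun _ => c).
Proof. intros x; apply continuous_const. Qed.

Lemma cont_plus h k : cont h -> cont k -> cont (fun x => h x + k x).
Proof. intros H K x; apply @continuous_plus; [apply H | apply K]. Qed.

Lemma cont_mult h k : cont h -> cont k -> cont (fun x => h x * k x).
Proof. intros H K x; apply @continuous_mult; [apply H | apply K]. Qed.

Lemma cont_comp h k : cont h -> cont k -> cont (fun x => k (h x)).
Proof. intros H K x; apply continuous_comp; [apply H | apply K]. Qed.

Lemma cont_pow h n : cont h -> cont (fun x => h x ^ n).
Proof.
  intros H; induction n as [|n IH]; [exact (cont_const 1) |].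
  exact (cont_mult _ _ H IH).
Qed.

Lemma cont_id : cont (fun x => x).
Proof. intros x; apply continuous_id. Qed.

Lemma cont_weight N h : cont h -> cont (fun s => INR N * s ^ (N - 1) * h s).
Proof.
  intros H; apply cont_mult; [| exact H].
  apply cont_mult; [apply cont_const | apply cont_pow, cont_id].
Qed.

Lemma weight_ge0 N s : 0 <= s -> 0 <= INR N * s ^ (N - 1).
Proof. intros H; apply Rmult_le_pos; [apply pos_INR | apply pow_le, H]. Qed.

Lemma weight_gt0 N s : (1 <= N)%nat -> 0 < s -> 0 < INR N * s ^ (N - 1).
Proof. intros HN H; apply Rmult_lt_0_compat; [apply lt_0_INR; lia | apply pow_lt, H]. Qed.

Lemma wint_derive N h t : cont h ->
  is_derive (wint N h) t (INR N * t ^ (N - 1) * h t).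
Proof. intros H; exact (cont_RInt_derive _ 0 t (cont_weight N h H)). Qed.

Lemma wint_cont N h : cont h -> cont (wint N h).
Proof. intros H; eapply is_derive_cont; intros x; apply wint_derive, H. Qed.

Lemma wint_0 N h : wint N h 0 = 0.
Proof. apply @RInt_point. Qed.

Lemma root_wint_cont N h : (1 <= N)%nat -> cont h ->
  cont (fun t => root N (wint N h t)).
Proof.
  intros HN H; apply cont_comp; [apply wint_cont, H | intros x; apply root_continuous, HN].
Qed.

Lemma rint_derive N h r : (1 <= N)%nat -> cont h ->
  is_derive (rint N h) r (root N (wint N h r)).
Proof. intros HN H; exact (cont_RInt_derive _ 0 r (root_wint_cont N h HN H)). Qed.

Lemma rint_cont N h : (1 <= N)%nat -> cont h -> cont (rint N h).
Proof. intros HN H; eapply is_derive_cont; intros x; apply rint_derive; assumption. Qed.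

Lemma rint_0 N h : rint N h 0 = 0.
Proof. apply @RInt_point. Qed.

Lemma wint_ext N h k t : 0 <= t -> (forall s, 0 <= s <= t -> h s = k s) ->
  wint N h t = wint N k t.
Proof.
  intros Ht E; apply RInt_ext; intros s.
  rewrite Rmin_left, Rmax_right by assumption; intros Hs; rewrite E by lra; reflexivity.
Qed.

Lemma rint_ext N h k r : 0 <= r -> (forall s, 0 <= s <= r -> h s = k s) ->
  rint N h r = rint N k r.
Proof.
  intros Hr E; apply RInt_ext; intros t.
  rewrite Rmin_left, Rmax_right by assumption; intros Ht.
  f_equal; apply wint_ext; [lra | intros; apply E; lra].
Qed.

Lemma wint_le N h k t : cont h -> cont k -> 0 <= t ->
  (forall s, 0 <= s <= t -> h s <= k s) -> wint N h t <= wint N k t.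
Proof.
  intros Hh Hk Ht H; apply RInt_le; auto using cont_ex_RInt, cont_weight.
  intros s Hs; apply Rmult_le_compat_l; [apply weight_ge0; lra | apply H; lra].
Qed.

Lemma wint_affine N h a c t : (1 <= N)%nat -> cont h ->
  wint N (fun s => a * h s + c) t = a * wint N h t + c * t ^ N.
Proof.
  intros HN H.
  apply is_RInt_unique.
  apply is_RInt_ext with
    (fun s => plus (scal a (INR N * s ^ (N - 1) * h s)) (scal c (INR N * s ^ (N - 1)))).
  { intros s _; unfold plus, scal; simpl; unfold mult; simpl; ring. }
  apply @is_RInt_plus; apply @is_RInt_scal.
  - exact (RInt_correct _ _ _ (cont_ex_RInt _ _ _ (cont_weight N h H))).
  - replace (t ^ N) with (minus (t ^ N) (0 ^ N))
      by (unfold minus, plus, opp; simpl; rewrite (pow_i N) by lia; ring).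
    apply (is_RInt_derive (fun s => s ^ N)).
    + intros s _; auto_derive; [trivial |].
      replace (Init.Nat.pred N) with (N - 1)%nat by lia; ring.
    + intros s _; apply cont_mult; [apply cont_const | apply cont_pow, cont_id].
Qed.

Lemma wint_const N c t : (1 <= N)%nat -> wint N (fun _ => c) t = c * t ^ N.
Proof.
  intros HN.
  transitivity (wint N (fun s => 0 * (fun _ => 0) s + c) t).
  - apply RInt_ext; intros; f_equal; ring.
  - rewrite wint_affine; [ring | assumption | apply cont_const].
Qed.

Lemma wint_ge0 N h t : (1 <= N)%nat -> cont h -> 0 <= t ->
  (forall s, 0 <= s <= t -> 0 <= h s) -> 0 <= wint N h t.
Proof.
  intros HN Hh Ht H; replace 0 with (0 * t ^ N) at 1 by ring.
  rewrite <- wint_const by assumption; apply wint_le; auto using cont_const.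
Qed.

Lemma RInt_split h a b c : cont h -> RInt h a c = RInt h a b + RInt h b c.
Proof. intros H; symmetry; apply @RInt_Chasles; apply cont_ex_RInt, H. Qed.

Lemma wint_incr N h t t' : cont h -> 0 <= t <= t' ->
  (forall s, 0 <= s <= t' -> 0 <= h s) -> wint N h t <= wint N h t'.
Proof.
  intros Hh Ht H; unfold wint; rewrite (RInt_split _ 0 t t') by (apply cont_weight, Hh).
  assert (0 <= RInt (fun s => INR N * s ^ (N - 1) * h s) t t'); [| lra].
  apply RInt_ge_0; [lra | apply cont_ex_RInt, cont_weight, Hh |].
  intros s Hs; apply Rmult_le_pos; [apply weight_ge0; lra | apply H; lra].
Qed.

Lemma wint_incr_strict N h t t' : (1 <= N)%nat -> cont h -> 0 <= t < t' ->
  (forall s, t < s < t' -> 0 < h s) -> wint N h t < wint N h t'.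
Proof.
  intros HN Hh Ht H; unfold wint; rewrite (RInt_split _ 0 t t') by (apply cont_weight, Hh).
  assert (0 < RInt (fun s => INR N * s ^ (N - 1) * h s) t t'); [| lra].
  apply RInt_gt_0; [lra | | intros; apply cont_weight, Hh].
  intros s Hs; apply Rmult_lt_0_compat; [apply weight_gt0; [assumption | lra] | apply H; lra].
Qed.

Lemma rint_diff N h r r' : (1 <= N)%nat -> cont h ->
  rint N h r' - rint N h r = RInt (fun t => root N (wint N h t)) r r'.
Proof.
  intros HN H; unfold rint; rewrite (RInt_split _ 0 r r') by (apply root_wint_cont; assumption).
  ring.
Qed.

Lemma rint_diff_le N h r r' C : (1 <= N)%nat -> cont h -> r <= r' ->
  (forall t, r <= t <= r' -> root N (wint N h t) <= C) ->
  rint N h r' - rint N h r <= C * (r' - r).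
Proof.
  intros HN H Hr HC; rewrite rint_diff by assumption.
  replace (C * (r' - r)) with (RInt (fun _ => C) r r')
    by (rewrite RInt_const; unfold scal; simpl; unfold mult; simpl; ring).
  apply RInt_le; auto using cont_ex_RInt, cont_const, root_wint_cont.
  intros t Ht; apply HC; lra.
Qed.

Lemma rint_diff_ge N h r r' C : (1 <= N)%nat -> cont h -> r <= r' ->
  (forall t, r <= t <= r' -> C <= root N (wint N h t)) ->
  C * (r' - r) <= rint N h r' - rint N h r.
Proof.
  intros HN H Hr HC; rewrite rint_diff by assumption.
  replace (C * (r' - r)) with (RInt (fun _ => C) r r')
    by (rewrite RInt_const; unfold scal; simpl; unfold mult; simpl; ring).
  apply RInt_le; auto using cont_ex_RInt, cont_const, root_wint_cont.
  intros t Ht; apply HC; lra.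
Qed.

Lemma rint_incr N h r r' : (1 <= N)%nat -> cont h -> r <= r' ->
  rint N h r <= rint N h r'.
Proof.
  intros HN H Hr; assert (E := rint_diff_ge N h r r' 0 HN H Hr (fun t _ => root_nonneg N _)).
  lra.
Qed.

Lemma rint_diff_compare N h k r r' a b : (1 <= N)%nat -> cont h -> cont k -> r <= r' ->
  (forall t, r <= t <= r' -> a * root N (wint N h t) <= b * root N (wint N k t)) ->
  a * (rint N h r' - rint N h r) <= b * (rint N k r' - rint N k r).
Proof.
  intros HN Hh Hk Hr H; rewrite !rint_diff by assumption.
  assert (Ch := root_wint_cont N h HN Hh); assert (Ck := root_wint_cont N k HN Hk).
  rewrite <- (RInt_scal (V := R_CompleteNormedModule) _ r r' a) by (apply cont_ex_RInt, Ch).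
  rewrite <- (RInt_scal (V := R_CompleteNormedModule) _ r r' b) by (apply cont_ex_RInt, Ck).
  apply RInt_le; [assumption | apply @ex_RInt_scal, cont_ex_RInt, Ch
                 | apply @ex_RInt_scal, cont_ex_RInt, Ck |].
  intros t Ht; apply H; lra.
Qed.

Lemma root_wint_le N h K t : (1 <= N)%nat -> cont h -> 0 <= t <= 1 -> 0 <= K ->
  (forall s, 0 <= s <= 1 -> h s <= K) -> root N (wint N h t) <= root N K.
Proof.
  intros HN Hh Ht HK H; apply root_le; [assumption |].
  apply Rle_trans with (wint N (fun _ => K) t).
  - apply wint_le; auto using cont_const; [lra | intros; apply H; lra].
  - rewrite wint_const by assumption.
    assert (t ^ N <= 1 ^ N) by (apply pow_incr; lra); rewrite pow1 in *; nra.
Qed.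

Lemma rint_lipschitz N h K r r' : (1 <= N)%nat -> cont h -> 0 <= r <= 1 -> 0 <= r' <= 1 ->
  0 <= K -> (forall s, 0 <= s <= 1 -> h s <= K) ->
  Rabs (rint N h r - rint N h r') <= root N K * Rabs (r - r').
Proof.
  intros HN Hh; revert r r'.
  assert (A : forall r r', r <= r' -> 0 <= r <= 1 -> 0 <= r' <= 1 -> 0 <= K ->
    (forall s, 0 <= s <= 1 -> h s <= K) ->
    Rabs (rint N h r - rint N h r') <= root N K * Rabs (r - r')).
  { intros r r' Hrr Hr Hr' HK H.
    assert (B := rint_incr N h r r' HN Hh Hrr).
    assert (rint N h r' - rint N h r <= root N K * (r' - r)).
    { apply rint_diff_le; auto; intros t Ht; apply root_wint_le; auto; lra. }
    rewrite (Rabs_left1 (rint N h r - _)), (Rabs_left1 (r - r')) by lra; lra. }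
  intros r r' Hr Hr' HK H; destruct (Rle_dec r r'); [apply A; auto |].
  rewrite (Rabs_minus_sym (rint N h r)), (Rabs_minus_sym r); apply A; auto; lra.
Qed.

(** An error [e ^ N] in the integrand changes [wint] by at most [e ^ N * t ^ N <= e ^ N], hence its
    root by at most [e], and the outer integral runs over a length at most 1. *)
Lemma rint_unif N h k e r : (1 <= N)%nat -> cont h -> cont k -> 0 <= r <= 1 -> 0 <= e ->
  (forall s, 0 <= s <= 1 -> Rabs (h s - k s) <= e ^ N) ->
  Rabs (rint N h r - rint N k r) <= e.
Proof.
  intros HN Hh Hk Hr He H.
  assert (HeN : 0 <= e ^ N) by (apply pow_le; assumption).
  assert (W : forall h k, cont h -> cont k ->
    (forall s, 0 <= s <= 1 -> Rabs (h s - k s) <= e ^ N) ->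
    forall t, 0 <= t <= 1 -> wint N h t <= wint N k t + e ^ N).
  { clear h k Hh Hk H; intros h k Hh Hk H t Ht.
    apply Rle_trans with (wint N (fun s => 1 * k s + e ^ N) t).
    - apply wint_le; [exact Hh | | lra |].
      + apply cont_plus; [apply cont_mult; [apply cont_const | exact Hk] | apply cont_const].
      + intros s Hs; assert (B := H s ltac:(lra)); apply Rabs_le_between in B; lra.
    - rewrite wint_affine by assumption.
      assert (t ^ N <= 1 ^ N) by (apply pow_incr; lra); rewrite pow1 in *; nra. }
  assert (D : forall t, 0 <= t <= 1 ->
    Rabs (root N (wint N h t) - root N (wint N k t)) <= e).
  { intros t Ht; apply root_unif; try assumption; apply Rabs_le.
    assert (A := W h k Hh Hk H t Ht).
    assert (B := W k h Hk Hh
      (fun s Hs => eq_ind _ (fun z => z <= e ^ N) (H s Hs) _ (Rabs_minus_sym _ _)) t Ht).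
    lra. }
  unfold rint.
  assert (Ch := root_wint_cont N h HN Hh); assert (Ck := root_wint_cont N k HN Hk).
  change (Rabs (minus (RInt (fun t => root N (wint N h t)) 0 r)
    (RInt (fun t => root N (wint N k t)) 0 r)) <= e).
  rewrite <- (RInt_minus (V := R_CompleteNormedModule)) by (apply cont_ex_RInt; assumption).
  apply Rle_trans with ((r - 0) * e); [| nra].
  apply abs_RInt_le_const; [lra | apply @ex_RInt_minus; apply cont_ex_RInt; assumption |].
  intros t Ht; apply D; lra.
Qed.

(** * Limits along an ultrafilter *)

(** [ultra_tail] makes the ultrafilter free. Every bounded sequence converges along it, so the data,
    the functions and their values at 1 all have limits at once, with no successive extraction of
    subsequences. *)
Record ultrafilter (U : (nat -> Prop) -> Prop) : Prop := {
  ultra_true : U (fun _ => True);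
  ultra_and : forall A B, U A -> U B -> U (fun n => A n /\ B n);
  ultra_impl : forall A B : nat -> Prop, (forall n, A n -> B n) -> U A -> U B;
  ultra_ex : forall A, U A -> exists n, A n;
  ultra_dec : forall A, U A \/ U (fun n => ~ A n);
  ultra_tail : forall m, U (fun n => (m <= n)%nat)
}.

Lemma ultrafilter_exists : exists U, ultrafilter U.
Proof.
  set (F := fun A : nat -> Prop => exists m, forall n, (m <= n)%nat -> A n).
  assert (FF : filter.ProperFilter F).
  { split.
    - intros [m Hm]; exact (Hm m (le_n m)).
    - split.
      + exists 0%nat; intros; exact I.
      + intros A B [m Hm] [p Hp]; exists (max m p); intros n Hn.
        split; [apply Hm | apply Hp]; lia.
      + intros A B HAB [m Hm]; exists m; intros n Hn; apply HAB, Hm, Hn. }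
  destruct (filter.ultraFilterLemma FF) as [G [HG HFG]].
  assert (PG := @filter.ultra_proper _ _ HG).
  assert (FG := @filter.filter_filter _ _ PG).
  exists G; split.
  - apply (@filter.filterT _ _ FG).
  - intros A B; apply (@filter.filterI _ _ FG).
  - intros A B H; apply (@filter.filterS _ _ FG); exact H.
  - intros A HA; apply NNPP; intros HN.
    apply (@filter.filter_not_empty _ _ PG).
    apply (@filter.filterS _ _ FG) with (2 := HA); intros n Hn.
    exfalso; apply HN; exists n; exact Hn.
  - intros A; apply (filter.in_ultra_setVsetC A HG).
  - intros m; apply HFG; exists m; auto.
Qed.

Definition ulim (U : (nat -> Prop) -> Prop) (u : nat -> R) (l : R) : Prop :=
  forall e, 0 < e -> U (fun n => Rabs (u n - l) < e).

(** The limit is the supremum of the levels [x] that [u] exceeds on a set of [U]. *)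
Lemma ulim_exists U u a b : ultrafilter U -> (forall n, a <= u n <= b) ->
  exists l, ulim U u l.
Proof.
  intros HU Hu.
  destruct (completeness (fun x => U (fun n => x <= u n))) as [l [Hub Hlub]].
  - exists b; intros x Hx; destruct (ultra_ex U HU _ Hx) as [n Hn]; specialize (Hu n); lra.
  - exists a; apply (ultra_impl U HU (fun _ => True)); [intros n _; apply Hu | apply ultra_true, HU].
  - exists l; intros e He.
    assert (H1 : U (fun n => ~ (l + e / 2 <= u n))).
    { destruct (ultra_dec U HU (fun n => l + e / 2 <= u n)) as [H | H]; [| exact H].
      exfalso; specialize (Hub _ H); lra. }
    assert (H2 : U (fun n => l - e / 2 <= u n)).
    { destruct (ultra_dec U HU (fun n => l - e / 2 <= u n)) as [H | H]; [exact H |].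
      exfalso; apply (Rlt_not_le l (l - e / 2)); [lra |].
      apply Hlub; intros x Hx; apply Rnot_lt_le; intros Hlt.
      destruct (ultra_ex U HU _ (ultra_and U HU _ _ H Hx)) as [n [Hn1 Hn2]]; lra. }
    apply (ultra_impl U HU) with (2 := ultra_and U HU _ _ H1 H2).
    intros n [A B]; apply Rabs_def1; lra.
Qed.

Lemma ulim_le U u l b : ultrafilter U -> ulim U u l -> U (fun n => u n <= b) -> l <= b.
Proof.
  intros HU Hl Hb; apply Rnot_lt_le; intros Hlt.
  destruct (ultra_ex U HU _ (ultra_and U HU _ _ Hb (Hl (l - b) ltac:(lra)))) as [n [A B]].
  apply Rabs_def2 in B; lra.
Qed.

Lemma ulim_opp U u l : ultrafilter U -> ulim U u l -> ulim U (fun n => - u n) (- l).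
Proof.
  intros HU Hl e He; apply (ultra_impl U HU) with (2 := Hl e He); intros n Hn.
  rewrite <- Rabs_Ropp; replace (- (- u n - - l)) with (u n - l) by ring; exact Hn.
Qed.

Lemma ulim_ge U u l a : ultrafilter U -> ulim U u l -> U (fun n => a <= u n) -> a <= l.
Proof.
  intros HU Hl Ha; assert (H := ulim_le U _ _ (- a) HU (ulim_opp U u l HU Hl)).
  cut (- l <= - a); [lra | apply H].
  apply (ultra_impl U HU) with (2 := Ha); intros; lra.
Qed.

(** Pointwise limits along [U] exist at all points simultaneously, so no countable dense set or
    diagonal argument is needed; the common Lipschitz constant passes to the limit. *)
Lemma ultra_ascoli U (w : nat -> R -> R) a b L : ultrafilter U ->
  (forall n x, a <= w n x <= b) ->
  (forall n x y, Rabs (w n x - w n y) <= L * Rabs (x - y)) ->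
  exists v : R -> R,
    (forall x y, Rabs (v x - v y) <= L * Rabs (x - y)) /\
    (forall e, 0 < e -> U (fun n => forall x, 0 <= x <= 1 -> Rabs (w n x - v x) <= e)).
Proof.
  intros HU Hab HL.
  destruct (boolp.choice (fun x => ulim_exists U (fun n => w n x) a b HU (fun n => Hab n x)))
    as [v Hv].
  assert (Lv : forall x y, Rabs (v x - v y) <= L * Rabs (x - y)).
  { intros x y; apply Rnot_lt_le; intros Hlt.
    set (e := (Rabs (v x - v y) - L * Rabs (x - y)) / 2).
    destruct (ultra_ex U HU _ (ultra_and U HU _ _ (Hv x e ltac:(unfold e; lra))
      (Hv y e ltac:(unfold e; lra)))) as [n [A B]].
    assert (C := HL n x y).
    assert (D : Rabs (v x - v y) <= Rabs (w n x - v x) + Rabs (w n x - w n y) + Rabs (w n y - v y)).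
    { replace (v x - v y) with (- (w n x - v x) + (w n x - w n y) + (w n y - v y)) by ring.
      eapply Rle_trans; [apply Rabs_triang |]; apply Rplus_le_compat_r.
      eapply Rle_trans; [apply Rabs_triang |]; rewrite Rabs_Ropp; lra. }
    unfold e in *; lra. }
  exists v; split; [exact Lv |]; intros e He.
  destruct (ultra_dec U HU (fun n => forall x, 0 <= x <= 1 -> Rabs (w n x - v x) <= e))
    as [H | H]; [exact H | exfalso].
  (* Points where the error exceeds [e] accumulate along [U] at some [y], and there
     equicontinuity contradicts pointwise convergence. *)
  assert (HX : forall n, exists x, 0 <= x <= 1 /\
    (~ (forall x, 0 <= x <= 1 -> Rabs (w n x - v x) <= e) -> e < Rabs (w n x - v x))).
  { intros n; destruct (classic (forall x, 0 <= x <= 1 -> Rabs (w n x - v x) <= e)) as [C | C].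
    - exists 0; split; [lra | tauto].
    - apply not_all_ex_not in C; destruct C as [x C]; apply imply_to_and in C.
      exists x; split; [tauto | intros _; apply Rnot_le_lt; tauto]. }
  destruct (boolp.choice HX) as [x Hx].
  destruct (ulim_exists U x 0 1 HU (fun n => proj1 (Hx n))) as [y Hy].
  assert (L0 : 0 <= L).
  { assert (A := Lv 1 0); rewrite Rminus_0_r, Rabs_R1 in A.
    assert (B := Rabs_pos (v 1 - v 0)); lra. }
  (* Three errors of at most [e / 4] are added below, which stays under [e]; [L + 1] avoids dividing
     by a zero Lipschitz constant. *)
  assert (Hd : 0 < e / (4 * (L + 1))) by (apply Rdiv_lt_0_compat; lra).
  destruct (ultra_ex U HU _ (ultra_and U HU _ _ H
    (ultra_and U HU _ _ (Hy _ Hd) (Hv y (e / 4) ltac:(lra))))) as [n [A [B C]]].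
  apply (proj2 (Hx n)) in A.
  assert (D1 := HL n (x n) y); assert (D2 := Lv (x n) y).
  assert (D3 : L * Rabs (x n - y) <= e / 4).
  { apply Rle_trans with ((L + 1) * (e / (4 * (L + 1)))).
    - apply Rmult_le_compat; try lra; apply Rabs_pos.
    - right; field; lra. }
  assert (D4 : Rabs (w n (x n) - v (x n)) <=
    Rabs (w n (x n) - w n y) + Rabs (w n y - v y) + Rabs (v (x n) - v y)).
  { replace (w n (x n) - v (x n))
      with ((w n (x n) - w n y) + (w n y - v y) + - (v (x n) - v y)) by ring.
    eapply Rle_trans; [apply Rabs_triang |]; rewrite Rabs_Ropp; apply Rplus_le_compat_r, Rabs_triang. }
  lra.
Qed.

(** * Tonelli approximation and shooting *)

(** Nearest-point projection onto [a,b]. It extends functions known on an interval to the line,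
    keeping continuity, so that integrals and continuity can be handled for total functions. *)
Definition clip (a b x : R) : R := Rmax a (Rmin x b).

Lemma clip_range a b x : a <= b -> a <= clip a b x <= b.
Proof. intros; unfold clip, Rmax, Rmin; repeat destruct Rle_dec; lra. Qed.

Lemma clip_id a b x : a <= x <= b -> clip a b x = x.
Proof. intros; unfold clip, Rmax, Rmin; repeat destruct Rle_dec; lra. Qed.

Lemma clip_lipschitz a b x y : Rabs (clip a b x - clip a b y) <= Rabs (x - y).
Proof.
  unfold clip, Rmax, Rmin; repeat destruct Rle_dec; unfold Rabs; repeat destruct Rcase_abs; lra.
Qed.

Lemma lipschitz_cont (h : R -> R) L :
  (forall x y, Rabs (h x - h y) <= L * Rabs (x - y)) -> cont h.
Proof.
  intros H x; apply continuity_pt_filterlim, continuity_pt_locally; intros [e He].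
  assert (L0 : 0 <= L).
  { assert (A := H 1 0); rewrite Rminus_0_r, Rabs_R1 in A.
    assert (B := Rabs_pos (h 1 - h 0)); lra. }
  assert (Hd : 0 < e / (L + 1)) by (apply Rdiv_lt_0_compat; lra).
  exists (mkposreal _ Hd); intros y Hy; simpl in *.
  apply Rle_lt_trans with (1 := H y x).
  apply Rle_lt_trans with ((L + 1) * Rabs (y - x)).
  - assert (P := Rabs_pos (y - x)); lra.
  - replace e with ((L + 1) * (e / (L + 1))) by (field; lra).
    apply Rmult_lt_compat_l; [lra | exact Hy].
Qed.

Definition unif_cont (G : R -> R) : Prop :=
  forall e, 0 < e -> exists d, 0 < d /\ forall x y, Rabs (x - y) <= d -> Rabs (G x - G y) <= e.

Lemma unif_cont_cont G : unif_cont G -> cont G.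
Proof.
  intros H x; apply continuity_pt_filterlim, continuity_pt_locally; intros [e He].
  destruct (H (e / 2) ltac:(lra)) as [d [Hd Hd']].
  exists (mkposreal _ Hd); intros y Hy; simpl in *.
  apply Rle_lt_trans with (e / 2); [apply Hd'; left; exact Hy | lra].
Qed.

Definition radial_sol (N : nat) (G : R -> R) (lam d : R) (w : R -> R) : Prop :=
  cont w /\ forall r, 0 <= r <= 1 -> w r = d - lam * rint N (fun s => G (w s)) r.

(* Tonelli's delayed Picard iterates: with delay [h], the [k]-th iterate is already
   stationary on [[0, k h]]. *)
Fixpoint tonelli (N : nat) (G : R -> R) (lam h d : R) (k : nat) : R -> R :=
  match k with
  | O => fun _ => d
  | S k => fun r => d - lam * rint N (fun s => G (tonelli N G lam h d k s)) (clip 0 1 (r - h))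
  end.

Section Tonelli.

Context (N : nat) (G : R -> R) (lam K : R).
Context (HN : (1 <= N)%nat) (Hlam : 0 <= lam) (HG : unif_cont G)
  (HK : forall s, 0 <= G s <= K).

Lemma bound_ge0 : 0 <= K.
Proof. specialize (HK 0); lra. Qed.

(** The constant is independent of the delay, the datum and the number of iterations: this is the
    equicontinuity required for the limit. *)
Lemma tonelli_lipschitz h d k x y :
  Rabs (tonelli N G lam h d k x - tonelli N G lam h d k y) <= lam * root N K * Rabs (x - y).
Proof.
  revert x y; induction k as [|k IH]; intros x y.
  - simpl; rewrite Rminus_diag, Rabs_R0.
    apply Rmult_le_pos; [apply Rmult_le_pos; [exact Hlam | apply root_nonneg] | apply Rabs_pos].
  - simpl; set (q := rint N _).
    replace (d - lam * q (clip 0 1 (x - h)) - (d - lam * q (clip 0 1 (y - h))))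
      with (lam * (q (clip 0 1 (y - h)) - q (clip 0 1 (x - h)))) by ring.
    rewrite Rabs_mult, (Rabs_right lam), Rmult_assoc by lra.
    apply Rmult_le_compat_l; [exact Hlam |].
    apply Rle_trans with (root N K * Rabs (clip 0 1 (y - h) - clip 0 1 (x - h))).
    + apply rint_lipschitz; try apply clip_range; try lra; try exact HN.
      * apply cont_comp; [exact (lipschitz_cont _ _ IH) | apply unif_cont_cont, HG].
      * apply bound_ge0.
      * intros; apply HK.
    + apply Rmult_le_compat_l; [apply root_nonneg |].
      apply Rle_trans with (1 := clip_lipschitz 0 1 _ _); right.
      rewrite Rabs_minus_sym; f_equal; ring.
Qed.

Lemma tonelli_cont h d k : cont (fun s => G (tonelli N G lam h d k s)).
Proof.
  apply cont_comp; [exact (lipschitz_cont _ _ (tonelli_lipschitz h d k)) | apply unif_cont_cont, HG].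
Qed.

Lemma rint_bounds w r : cont w -> 0 <= r <= 1 ->
  0 <= rint N (fun s => G (w s)) r <= root N K.
Proof.
  intros Hw Hr; assert (C : cont (fun s => G (w s))) by (apply cont_comp, unif_cont_cont, HG; exact Hw).
  assert (A := rint_incr N _ 0 r HN C (proj1 Hr)).
  assert (B := rint_lipschitz N _ K r 0 HN C Hr ltac:(lra) bound_ge0 (fun s _ => proj2 (HK (w s)))).
  rewrite rint_0 in *; rewrite !Rminus_0_r, (Rabs_right r) in B by lra.
  apply Rabs_le_between in B; assert (P := root_nonneg N K); nra.
Qed.

Lemma tonelli_bounds h d k r : d - lam * root N K <= tonelli N G lam h d k r <= d.
Proof.
  assert (P := root_nonneg N K).
  destruct k as [|k]; simpl; [nra |].
  assert (B := rint_bounds (tonelli N G lam h d k) (clip 0 1 (r - h))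
    (lipschitz_cont _ _ (tonelli_lipschitz h d k)) (clip_range 0 1 _ ltac:(lra))).
  nra.
Qed.

Lemma tonelli_stationary h d k r : 0 <= h -> 0 <= r <= 1 -> r <= INR k * h ->
  tonelli N G lam h d (S k) r = tonelli N G lam h d k r.
Proof.
  intros Hh; revert r; induction k as [|k IH]; intros r Hr Hk.
  - simpl in *; replace (clip 0 1 (r - h)) with 0; [rewrite rint_0; ring |].
    unfold clip, Rmax, Rmin; repeat destruct Rle_dec; lra.
  - assert (E : rint N (fun s => G (tonelli N G lam h d (S k) s)) (clip 0 1 (r - h)) =
      rint N (fun s => G (tonelli N G lam h d k s)) (clip 0 1 (r - h))).
    { assert (B := clip_range 0 1 (r - h) ltac:(lra)).
      apply rint_ext; [lra |]; intros s Hs; f_equal; apply IH; [lra |].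
      apply Rle_trans with (1 := proj2 Hs).
      assert (0 <= INR k * h) by (apply Rmult_le_pos; [apply pos_INR | exact Hh]).
      rewrite S_INR in Hk.
      unfold clip, Rmax, Rmin; repeat destruct Rle_dec; lra. }
    change (d - lam * rint N (fun s => G (tonelli N G lam h d (S k) s)) (clip 0 1 (r - h)) =
      d - lam * rint N (fun s => G (tonelli N G lam h d k s)) (clip 0 1 (r - h))).
    rewrite E; reflexivity.
Qed.

(** Each iterate is an explicit integral of the previous one, so continuity in the datum follows by
    induction on [k]. Half of [e] goes to the change of [d], half to [lam] times the change of the
    integral. The intermediate value theorem relies on this. *)
Lemma tonelli_unif_datum h k e : 0 < e -> exists delta, 0 < delta /\
  forall d d', Rabs (d - d') <= delta ->
  forall r, Rabs (tonelli N G lam h d k r - tonelli N G lam h d' k r) <= e.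
Proof.
  revert e; induction k as [|k IH]; intros e He.
  - exists e; simpl; auto.
  - assert (He1 : 0 < e / (2 * (lam + 1))) by (apply Rdiv_lt_0_compat; lra).
    set (e1 := e / (2 * (lam + 1))) in *.
    destruct (HG (e1 ^ N) (pow_lt _ _ He1)) as [d1 [Hd1 H1]].
    destruct (IH d1 Hd1) as [d2 [Hd2 H2]].
    exists (Rmin d2 (e / 2)); split; [apply Rmin_pos; lra |].
    intros d d' Hd r.
    assert (A : Rabs (d - d') <= d2) by (eapply Rle_trans; [exact Hd | apply Rmin_l]).
    assert (B : Rabs (d - d') <= e / 2) by (eapply Rle_trans; [exact Hd | apply Rmin_r]).
    assert (C : Rabs (rint N (fun s => G (tonelli N G lam h d k s)) (clip 0 1 (r - h)) -
      rint N (fun s => G (tonelli N G lam h d' k s)) (clip 0 1 (r - h))) <= e1).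
    { apply rint_unif; auto using tonelli_cont; [apply clip_range; lra | lra]. }
    simpl; apply Rabs_le_between in B; apply Rabs_le_between in C; apply Rabs_le.
    assert (E : lam * e1 <= e / 2).
    { apply Rle_trans with ((lam + 1) * e1); [nra | right; unfold e1; field; lra]. }
    nra.
Qed.

(** The datum may vary with [n], because the intermediate value theorem returns a different one for
    each approximation. *)
Lemma tonelli_limit U (d : nat -> R) a b : ultrafilter U -> (forall n, a <= d n <= b) ->
  exists d' w, a <= d' <= b /\ ulim U d d' /\ radial_sol N G lam d' w /\
    ulim U (fun n => tonelli N G lam (/ INR (S n)) (d n) (S n) 1) (w 1).
Proof.
  intros HU Hd.
  destruct (ulim_exists U d a b HU Hd) as [d' Hd'].
  set (W := fun n => tonelli N G lam (/ INR (S n)) (d n) (S n)).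
  destruct (ultra_ascoli U W (a - lam * root N K) b (lam * root N K) HU) as [w [Lw Hw]].
  { intros n x; assert (B := tonelli_bounds (/ INR (S n)) (d n) (S n) x).
    specialize (Hd n); unfold W; lra. }
  { intros n x y; apply tonelli_lipschitz. }
  assert (Cw := lipschitz_cont w _ Lw).
  assert (CGw : cont (fun s => G (w s))) by (apply cont_comp, unif_cont_cont, HG; exact Cw).
  exists d', w; split; [split | split; [exact Hd' | split; [split; [exact Cw |] |]]].
  - apply (ulim_ge U d d' a HU Hd').
    apply (ultra_impl U HU (fun _ => True)); [intros; apply Hd | apply ultra_true, HU].
  - apply (ulim_le U d d' b HU Hd').
    apply (ultra_impl U HU (fun _ => True)); [intros; apply Hd | apply ultra_true, HU].
  - intros r Hr; apply cond_eq; intros e He.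
    set (C := root N K); assert (HC : 0 <= C) by apply root_nonneg.
    (* The error in the limit equation is at most [2 * e1 + lam * (C + 1) * e1]: convergence of
       [W n] and of [d n], then the integral, where [C * e1] pays for the delay. *)
    set (e1 := e / (4 * (lam + 1) * (C + 1))).
    assert (He1 : 0 < e1).
    { apply Rdiv_lt_0_compat; [exact He |]; apply Rmult_lt_0_compat; lra. }
    destruct (HG (e1 ^ N) (pow_lt _ _ He1)) as [d1 [Hd1 H1]].
    destruct (archimed_cor1 e1 He1) as [m [Hm Hm0]].
    assert (Hd2 : 0 < Rmin d1 e1) by (apply Rmin_pos; assumption).
    destruct (ultra_ex U HU _ (ultra_and U HU _ _ (Hw _ Hd2)
      (ultra_and U HU _ _ (Hd' _ He1) (ultra_tail U HU m)))) as [n [A [B Hn]]].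
    assert (hpos : 0 < / INR (S n)) by (apply Rinv_0_lt_compat, lt_0_INR; lia).
    assert (hsmall : / INR (S n) <= e1).
    { left; apply Rle_lt_trans with (2 := Hm); apply Rinv_le_contravar.
      - apply lt_0_INR; lia.
      - apply le_INR; lia. }
    set (h := / INR (S n)) in *.
    (* With [S n] iterations of delay [1 / (n + 1)] the stationary range is all of [0,1], so [W n]
       solves the delayed equation exactly. *)
    assert (E : W n r = d n - lam * rint N (fun s => G (W n s)) (clip 0 1 (r - h))).
    { unfold W at 1; rewrite <- tonelli_stationary; [reflexivity | exact (Rlt_le _ _ hpos) | exact Hr |].
      unfold h; rewrite Rinv_r; [lra | apply not_0_INR; lia]. }
    assert (Hrho := clip_range 0 1 (r - h) ltac:(lra)).
    set (rho := clip 0 1 (r - h)) in *.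
    assert (F1 : Rabs (rint N (fun s => G (W n s)) rho - rint N (fun s => G (w s)) rho) <= e1).
    { apply rint_unif; auto; [apply tonelli_cont | lra |].
      intros s Hs; apply H1; eapply Rle_trans; [apply A, Hs | apply Rmin_l]. }
    assert (F2 : Rabs (rint N (fun s => G (w s)) rho - rint N (fun s => G (w s)) r) <= C * e1).
    { apply Rle_trans with (C * Rabs (rho - r)).
      - apply rint_lipschitz; auto; [apply bound_ge0 | intros; apply HK].
      - apply Rmult_le_compat_l; [exact HC |].
        apply Rle_trans with (2 := hsmall).
        unfold rho; rewrite <- (clip_id 0 1 r Hr) at 2.
        apply Rle_trans with (1 := clip_lipschitz 0 1 _ _).
        replace (r - h - r) with (- h) by ring; rewrite Rabs_Ropp, Rabs_right; lra. }
    assert (F3 : Rabs (W n r - w r) <= e1) by (eapply Rle_trans; [apply A, Hr | apply Rmin_r]).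
    rewrite E in F3.
    apply Rabs_le_between in F1; apply Rabs_le_between in F2; apply Rabs_le_between in F3.
    apply Rabs_def2 in B.
    assert (F4 : e1 * (4 * (lam + 1) * (C + 1)) = e) by (unfold e1; field; lra).
    set (X := rint N (fun s => G (W n s)) rho) in *.
    set (Y := rint N (fun s => G (w s)) rho) in *.
    set (Z := rint N (fun s => G (w s)) r) in *.
    assert (F5 : - ((C + 1) * e1) <= X - Z <= (C + 1) * e1) by lra.
    assert (F6 := Rmult_le_compat_l lam _ _ Hlam (proj1 F5)).
    assert (F6' := Rmult_le_compat_l lam _ _ Hlam (proj2 F5)).
    assert (F7 : 0 <= C * e1) by nra.
    assert (F8 : 0 <= lam * ((C + 1) * e1)) by (apply Rmult_le_pos; [exact Hlam | lra]).
    apply Rabs_def1; lra.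
  - intros e He; apply (ultra_impl U HU) with (2 := Hw (e / 2) ltac:(lra)).
    intros n Hn; apply Rle_lt_trans with (e / 2); [apply Hn; lra | lra].
Qed.

(** The factor [sg] covers both directions of the sign change. The assumed signs pass from exact
    solutions to [U]-almost all approximations, which therefore have a zero at 1 for some datum in
    [a,b]; the zero survives in the limit. *)
Lemma shooting sg a b : a <= b ->
  (forall w, radial_sol N G lam a w -> 0 < sg * w 1) ->
  (forall w, radial_sol N G lam b w -> sg * w 1 < 0) ->
  exists d w, a <= d <= b /\ radial_sol N G lam d w /\ w 1 = 0.
Proof.
  intros Hab Ha Hb.
  destruct ultrafilter_exists as [U HU].
  (* For the constant datum [c] the values [F n c] converge along [U] to [w 1] for some solution
     [w]. Nothing selects that solution, so the hypothesis on all of them is used. *)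
  set (F := fun n d => tonelli N G lam (/ INR (S n)) d (S n) 1).
  assert (Ev : forall c s, (forall w, radial_sol N G lam c w -> 0 < s * w 1) ->
    U (fun n => 0 < s * F n c)).
  { intros c s Hc.
    destruct (tonelli_limit U (fun _ => c) c c HU ltac:(intros; lra))
      as [c' [w [Hc' [_ [Hw Hl]]]]].
    replace c' with c in Hw by lra; specialize (Hc w Hw).
    assert (Hs : s <> 0) by (intros ->; lra).
    assert (He : 0 < Rabs (w 1)) by (apply Rabs_pos_lt; intros E; rewrite E in Hc; lra).
    apply (ultra_impl U HU) with (2 := Hl _ He); intros n Hn; fold (F n c) in Hn.
    destruct (Rle_lt_dec 0 (w 1)).
    - rewrite (Rabs_right (w 1)) in Hn by lra; apply Rabs_def2 in Hn.
      assert (0 < s) by nra; apply Rmult_lt_0_compat; lra.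
    - rewrite (Rabs_left (w 1)) in Hn by lra; apply Rabs_def2 in Hn.
      assert (s < 0) by nra; nra. }
  assert (Cont : forall n, continuity (F n)).
  { intros n x; apply continuity_pt_locally; intros [e He].
    destruct (tonelli_unif_datum (/ INR (S n)) (S n) (e / 2) ltac:(lra)) as [dl [Hdl H]].
    exists (mkposreal _ Hdl); intros y Hy; simpl in *.
    apply Rle_lt_trans with (e / 2); [| lra].
    apply (H y x (Rlt_le _ _ Hy) 1). }
  (* Where the end signs are wrong, the datum [a] is a filler; [E0] below shows that the zero is
     genuine on a set of [U]. *)
  assert (Z : forall n, exists d, a <= d <= b /\ (0 < sg * F n a /\ 0 < (- sg) * F n b -> F n d = 0)).
  { intros n; destruct (Classical_Prop.classic (0 < sg * F n a /\ 0 < (- sg) * F n b)) as [P | P].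
    - destruct (IVT_cor (F n) a b (Cont n) Hab) as [z [Hz Ez]].
      + assert (0 <= (sg * F n a) * (- sg * F n b)) by (apply Rmult_le_pos; lra).
        assert (0 < sg * sg) by (assert (sg <> 0) by (intros ->; lra); nra).
        nra.
      + exists z; auto.
    - exists a; split; [lra | tauto]. }
  destruct (boolp.choice Z) as [d Hd].
  destruct (tonelli_limit U d a b HU (fun n => proj1 (Hd n))) as [d' [w [Hd' [_ [Hw Hl]]]]].
  exists d', w; split; [exact Hd' | split; [exact Hw |]].
  assert (E0 : U (fun n => F n (d n) = 0)).
  { assert (E1 := Ev a sg Ha).
    assert (E2 := Ev b (- sg) (fun w Hw => ltac:(specialize (Hb w Hw); lra))).
    apply (ultra_impl U HU) with (2 := ultra_and U HU _ _ E1 E2).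
    intros n; apply (proj2 (Hd n)). }
  apply Rle_antisym.
  - apply (ulim_le U _ _ 0 HU Hl); apply (ultra_impl U HU) with (2 := E0).
    intros n; fold (F n (d n)); lra.
  - apply (ulim_ge U _ _ 0 HU Hl); apply (ultra_impl U HU) with (2 := E0).
    intros n; fold (F n (d n)); lra.
Qed.

End Tonelli.

(** * The first eigenfunction *)

Lemma cont_continuity h : cont h -> continuity h.
Proof. intros H x; apply continuity_pt_filterlim, H. Qed.

Lemma has_deriv_on_is_derive g g' a b x : has_deriv_on g g' a b -> a < x < b ->
  is_derive g x (g' x).
Proof.
  intros H Hx; apply is_derive_Reals; intros e He.
  destruct (H x ltac:(lra) e He) as [d [Hd Hd']].
  assert (Hm : 0 < Rmin d (Rmin (x - a) (b - x))) by (repeat apply Rmin_pos; lra).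
  exists (mkposreal _ Hm); intros k Hk0 Hk; simpl in Hk.
  assert (A := Rmin_l d (Rmin (x - a) (b - x))).
  assert (B := Rmin_r d (Rmin (x - a) (b - x))).
  assert (C := Rmin_l (x - a) (b - x)); assert (D := Rmin_r (x - a) (b - x)).
  assert (E : Rabs k < Rmin (x - a) (b - x)) by lra; apply Rabs_def2 in E.
  replace k with ((x + k) - x) at 2 by ring.
  apply Hd'; [lra | lra |]; replace (x + k - x) with k by ring; lra.
Qed.

Lemma has_deriv_on_continuous_on g g' a b : has_deriv_on g g' a b -> Defs.continuous_on g a b.
Proof.
  intros H x Hx e He.
  destruct (H x Hx 1 ltac:(lra)) as [d [Hd Hd']].
  set (M := Rabs (g' x) + 1); assert (HM : 0 < M) by (unfold M; assert (P := Rabs_pos (g' x)); lra).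
  assert (HeM : 0 < e / M) by (apply Rdiv_lt_0_compat; assumption).
  exists (Rmin d (e / M)); split; [apply Rmin_pos; assumption |].
  intros y Hy Hyx; destruct (Req_dec y x) as [-> | Hne].
  - rewrite Rminus_diag, Rabs_R0; exact He.
  - assert (A : Rabs ((g y - g x) / (y - x) - g' x) < 1).
    { apply Hd'; auto; apply Rlt_le_trans with (1 := Hyx), Rmin_l. }
    assert (B : Rabs ((g y - g x) / (y - x)) < M).
    { unfold M; replace ((g y - g x) / (y - x))
        with (((g y - g x) / (y - x) - g' x) + g' x) by ring.
      apply Rle_lt_trans with (1 := Rabs_triang _ _); lra. }
    assert (P : 0 < Rabs (y - x)) by (apply Rabs_pos_lt; lra).
    replace (g y - g x) with ((g y - g x) / (y - x) * (y - x)) by (field; lra).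
    rewrite Rabs_mult; apply Rlt_trans with (M * Rabs (y - x)).
    + apply Rmult_lt_compat_r; assumption.
    + replace e with (M * (e / M)) by (field; lra).
      apply Rmult_lt_compat_l; [exact HM | apply Rlt_le_trans with (1 := Hyx), Rmin_r].
Qed.

Lemma continuous_on_cont_clip g a b : a <= b -> Defs.continuous_on g a b ->
  cont (fun r => g (clip a b r)).
Proof.
  intros Hab H x; apply continuity_pt_filterlim, continuity_pt_locally; intros [e He].
  destruct (H (clip a b x) (clip_range a b x Hab) e He) as [d [Hd Hd']].
  exists (mkposreal _ Hd); intros y Hy; simpl in *.
  apply Hd'; [apply clip_range, Hab |].
  apply Rle_lt_trans with (1 := clip_lipschitz a b y x); exact Hy.
Qed.

Lemma is_derive_clip (g : R -> R) a b x (l : R) : a < x < b -> is_derive g x l ->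
  is_derive (fun r => g (clip a b r)) x l.
Proof.
  intros Hx; apply is_derive_ext_loc.
  assert (Hm : 0 < Rmin (x - a) (b - x)) by (apply Rmin_pos; lra).
  exists (mkposreal _ Hm); intros y Hy; simpl in Hy.
  apply Rabs_def2 in Hy; unfold minus, plus, opp in Hy; simpl in Hy.
  assert (C := Rmin_l (x - a) (b - x)); assert (D := Rmin_r (x - a) (b - x)).
  rewrite clip_id by lra; reflexivity.
Qed.

Lemma same_derive_diff (p q dp : R -> R) r : cont p -> cont q ->
  (forall x, 0 < x < 1 -> is_derive p x (dp x)) ->
  (forall x, 0 < x < 1 -> is_derive q x (dp x)) ->
  0 <= r <= 1 -> p r - q r = p 0 - q 0.
Proof.
  intros Cp Cq Dp Dq Hr.
  destruct (MVT_gen (fun x => p x - q x) 0 r (fun _ => 0)) as [c [_ E]]; [| | lra].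
  - rewrite Rmin_left, Rmax_right by lra; intros x Hx.
    replace 0 with (minus (dp x) (dp x)) by (unfold minus; apply @plus_opp_r).
    apply @is_derive_minus; [apply Dp | apply Dq]; lra.
  - intros x _; apply continuity_pt_minus; apply cont_continuity; assumption.
Qed.

Definition radial_eigen (N : nat) (lam1 : R) (V : R -> R) : Prop :=
  cont V /\ (forall r, 0 <= r <= 1 -> V r = V 0 - lam1 * rint N (fun s => V s ^ N) r) /\
  V 1 = 0 /\ (forall r, 0 <= r < 1 -> 0 < V r).

(** Integration gives (-V')^N = lam1^N * wint, which for even N leaves the sign of V' open. The
    right side is positive on (0,1], so V' has no zero there; being continuous and negative
    somewhere, it is negative throughout, and the N-th root can be taken. *)
Lemma pos_eigenfunction_radial N lam1 v : (1 <= N)%nat -> 0 < lam1 ->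
  pos_eigenfunction N lam1 v -> exists V, radial_eigen N lam1 V.
Proof.
  intros HN Hl [v1 [v2 [[D1 [D2 _]] [Eq [H0 [H1 Hpos]]]]]].
  set (V := fun r => v (clip 0 1 r)); set (V1 := fun r => v1 (clip 0 1 r)).
  assert (CV : cont V).
  { apply continuous_on_cont_clip; [lra | eapply has_deriv_on_continuous_on; exact D1]. }
  assert (CV1 : cont V1).
  { apply continuous_on_cont_clip; [lra | eapply has_deriv_on_continuous_on; exact D2]. }
  assert (EV : forall r, 0 <= r <= 1 -> V r = v r) by (intros; unfold V; rewrite clip_id; auto).
  assert (EV1 : forall r, 0 <= r <= 1 -> V1 r = v1 r) by (intros; unfold V1; rewrite clip_id; auto).
  assert (CVN : cont (fun s => V s ^ N)) by (apply cont_pow, CV).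
  assert (DV : forall x, 0 < x < 1 -> is_derive V x (V1 x)).
  { intros x Hx; rewrite EV1 by lra.
    apply is_derive_clip, (has_deriv_on_is_derive v v1 0 1); assumption. }
  assert (CV1N : cont (fun r => (- V1 r) ^ N)).
  { apply cont_pow; intros x; apply @continuous_opp, CV1. }
  assert (E1 : forall r, 0 <= r <= 1 -> (- V1 r) ^ N = lam1 ^ N * wint N (fun s => V s ^ N) r).
  { intros r Hr.
    assert (A := same_derive_diff (fun r => (- V1 r) ^ N)
      (fun r => lam1 ^ N * wint N (fun s => V s ^ N) r)
      (fun r => lam1 ^ N * (INR N * r ^ (N - 1) * V r ^ N)) r CV1N).
    cbv beta in A; rewrite wint_0, (EV1 0), H0, Ropp_0, (pow_i N) in A by (lra || lia).
    apply Rminus_diag_uniq; rewrite A; [ring | | | | exact Hr].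
    - apply cont_mult; [apply cont_const | apply wint_cont, CVN].
    - intros x Hx; apply (is_derive_clip (fun x => (- v1 x) ^ N)); [exact Hx |].
      apply is_derive_Reals; rewrite EV by lra.
      rewrite <- !Rmult_assoc; apply Eq, Hx.
    - intros x Hx; apply @is_derive_scal, wint_derive, CVN. }
  assert (Wpos : forall r, 0 < r <= 1 -> 0 < wint N (fun s => V s ^ N) r).
  { intros r Hr; rewrite <- (wint_0 N (fun s => V s ^ N)).
    apply wint_incr_strict; auto; [lra |].
    intros s Hs; apply pow_lt; rewrite EV by lra; apply Hpos; lra. }
  assert (V1nz : forall r, 0 < r <= 1 -> V1 r <> 0).
  { intros r Hr E; assert (A := E1 r ltac:(lra)).
    rewrite E, Ropp_0, (pow_i N) in A by lia.
    assert (B := Rmult_lt_0_compat _ _ (pow_lt lam1 N Hl) (Wpos r Hr)); lra. }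
  (* The mean value theorem between 1/2 and 1, where [V] drops from a positive value to 0. *)
  assert (Hc : exists c, / 2 <= c <= 1 /\ V1 c < 0).
  { destruct (MVT_gen V (/ 2) 1 V1) as [c [Hc E]].
    - rewrite Rmin_left, Rmax_right by lra; intros x Hx; apply DV; lra.
    - intros x _; apply cont_continuity, CV.
    - rewrite Rmin_left, Rmax_right in Hc by lra.
      exists c; split; [exact Hc |].
      rewrite !EV, H1 in E by lra; assert (P := Hpos (/ 2) ltac:(lra)); lra. }
  destruct Hc as [c [Hc V1c]].
  assert (V1neg : forall r, 0 < r <= 1 -> V1 r < 0).
  { intros r Hr; apply Rnot_le_lt; intros Hle.
    destruct (IVT_gen V1 r c 0 (cont_continuity _ CV1)) as [z [Hz Ez]].
    - rewrite Rmin_right, Rmax_left by lra; lra.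
    - apply (V1nz z); [| exact Ez]; revert Hz.
      unfold Rmin, Rmax; repeat destruct Rle_dec; lra. }
  assert (E2 : forall r, 0 <= r <= 1 -> V1 r = - lam1 * root N (wint N (fun s => V s ^ N) r)).
  { intros r Hr; destruct (Req_dec r 0) as [-> | Hr0].
    - rewrite EV1, H0, wint_0, root_npos by lra; ring.
    - assert (A := V1neg r ltac:(lra)); assert (B := Wpos r ltac:(lra)).
      assert (C : - V1 r = lam1 * root N (wint N (fun s => V s ^ N) r)).
      { rewrite <- root_scal by (auto; lra); rewrite <- E1 by exact Hr.
        rewrite pow_root; auto; lra. }
      lra. }
  assert (E3 : forall r, 0 <= r <= 1 -> V r = V 0 - lam1 * rint N (fun s => V s ^ N) r).
  { intros r Hr.
    assert (A := same_derive_diff V (fun r => - lam1 * rint N (fun s => V s ^ N) r) V1 r CV).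
    cbv beta in A; rewrite rint_0 in A.
    cut (V r - - lam1 * rint N (fun s => V s ^ N) r = V 0 - - lam1 * 0); [lra |].
    apply A; auto.
    - apply cont_mult; [apply cont_const | apply rint_cont; assumption].
    - intros x Hx; rewrite E2 by lra; apply @is_derive_scal, rint_derive; assumption. }
  exists V; split; [exact CV | split; [exact E3 | split; [rewrite EV by lra; exact H1 |]]].
  intros r Hr; destruct (Req_dec r 0) as [-> | Hr0].
  (* Positivity is assumed only inside the interval; at 0 it follows from V(0) >= V(1/2). *)
  - assert (P := Hpos (/ 2) ltac:(lra)); rewrite <- EV, E3 in P by lra.
    assert (Q := rint_incr N (fun s => V s ^ N) 0 (/ 2) HN CVN ltac:(lra)).
    rewrite rint_0 in Q; nra.
  - rewrite EV by lra; apply Hpos; lra.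
Qed.

(** * Comparison with the first eigenfunction *)

Section Comparison.

Context (N : nat) (lam1 : R) (V : R -> R).
Context (HN : (1 <= N)%nat) (Hlam1 : 0 < lam1) (HV : radial_eigen N lam1 V).

Let CV : cont V := proj1 HV.
Let CVN : cont (fun s => V s ^ N) := cont_pow V N CV.

Lemma eigen_pos r : 0 <= r < 1 -> 0 < V r.
Proof. apply HV. Qed.

Lemma eigen_ge0 r : 0 <= r <= 1 -> 0 <= V r.
Proof.
  intros Hr; destruct (Req_dec r 1) as [-> | H].
  - right; symmetry; apply HV.
  - left; apply eigen_pos; lra.
Qed.

Lemma eigen_eq r : 0 <= r <= 1 ->
  V r = lam1 * (rint N (fun s => V s ^ N) 1 - rint N (fun s => V s ^ N) r).
Proof.
  intros Hr; destruct (proj2 HV) as [E [E1 _]].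
  rewrite (E r Hr); rewrite (E 1) in E1 by lra; lra.
Qed.

Lemma eigen_decr r r' : 0 <= r <= r' -> r' <= 1 -> V r' <= V r.
Proof.
  intros Hr Hr'; rewrite (eigen_eq r), (eigen_eq r') by lra.
  assert (A := rint_incr N (fun s => V s ^ N) r r' HN CVN ltac:(lra)); nra.
Qed.

(** Up to 1/2 the decreasing [V] is at least V(1/2); beyond, the integral up to 1/2 already
    suffices, and the extra factor 1/2 pays for [t <= 1]. This bound later absorbs the error term
    [eta * d ^ N * t ^ N]. *)
Lemma eigen_wint_ge t : 0 <= t <= 1 ->
  (V (/ 2) / 2) ^ N * t ^ N <= wint N (fun s => V s ^ N) t.
Proof.
  intros Ht; assert (P := eigen_pos (/ 2) ltac:(lra)).
  assert (A : forall t, 0 <= t <= / 2 -> V (/ 2) ^ N * t ^ N <= wint N (fun s => V s ^ N) t).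
  { intros x Hx; rewrite <- wint_const by exact HN.
    apply wint_le; auto using cont_const; [lra |].
    intros s Hs; apply pow_incr; split; [lra | apply eigen_decr; lra]. }
  destruct (Rle_dec t (/ 2)).
  - apply Rle_trans with (2 := A t ltac:(lra)).
    apply Rmult_le_compat_r; [apply pow_le; lra | apply pow_incr; lra].
  - apply Rle_trans with (wint N (fun s => V s ^ N) (/ 2)).
    + apply Rle_trans with (2 := A (/ 2) ltac:(lra)).
      rewrite <- !Rpow_mult_distr; apply pow_incr; split; [apply Rmult_le_pos; lra | nra].
    + apply wint_incr; auto; [lra |].
      intros s Hs; apply pow_le, eigen_ge0; lra.
Qed.

(** A Hopf-type bound: on [1/2,1] the slope -V' is at least lam1 * V(1/2) / 4. Although [V] vanishes
    at 1, it thus dominates, up to a factor, any function that is Lipschitz and nonpositive at 1,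
    which starts the iteration for an upper bound. *)
Lemma eigen_ge_linear : exists k, 0 < k /\ forall r, 0 <= r <= 1 -> k * (1 - r) <= V r.
Proof.
  assert (P := eigen_pos (/ 2) ltac:(lra)).
  set (k := Rmin (lam1 * (V (/ 2) / 4)) (V (/ 2))).
  assert (K1 : k <= lam1 * (V (/ 2) / 4)) by apply Rmin_l.
  assert (K2 : k <= V (/ 2)) by apply Rmin_r.
  assert (K0 : 0 < k) by (apply Rmin_pos; [apply Rmult_lt_0_compat |]; lra).
  exists k; split; [exact K0 |]; intros r Hr; destruct (Rle_dec r (/ 2)) as [H | H].
  - assert (A := eigen_decr r (/ 2) ltac:(lra) ltac:(lra)); nra.
  - rewrite eigen_eq by exact Hr.
    assert (A : V (/ 2) / 4 * (1 - r) <=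
      rint N (fun s => V s ^ N) 1 - rint N (fun s => V s ^ N) r).
    { apply rint_diff_ge; auto; [lra |]; intros t Ht.
      rewrite <- (pow_root N (V (/ 2) / 4)) by (auto; lra).
      apply root_le; [exact HN |].
      apply Rle_trans with (2 := eigen_wint_ge t ltac:(lra)).
      rewrite <- Rpow_mult_distr; apply pow_incr; nra. }
    assert (B := Rmult_le_compat_l lam1 _ _ (Rlt_le _ _ Hlam1) A); nra.
Qed.

(** The slope -V' is at most lam1 * V(0). Combined with a linear lower bound for a solution, this
    starts the iteration from below. *)
Lemma eigen_le_linear r : 0 <= r <= 1 -> V r <= lam1 * V 0 * (1 - r).
Proof.
  intros Hr; rewrite (eigen_eq r Hr), Rmult_assoc.
  apply Rmult_le_compat_l; [lra |].
  assert (P := eigen_pos 0 ltac:(lra)).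
  apply rint_diff_le; auto; [lra |]; intros t Ht.
  rewrite <- (pow_root N (V 0)) by (auto; lra).
  apply root_wint_le; auto; [lra | apply pow_le; lra |].
  intros s Hs; apply pow_incr; split; [apply eigen_ge0; lra | apply eigen_decr; lra].
Qed.

Context (lam phi : R) (Hlam : 0 < lam) (Hphi : 0 < phi).

Section Solution.

Context (G : R -> R) (d : R) (w : R -> R).
Context (HG : cont G) (G0 : forall s, 0 <= G s) (Hw : radial_sol N G lam d w).

Let Cw : cont w := proj1 Hw.
Let CGw : cont (fun s => G (w s)) := cont_comp w G Cw HG.

Lemma sol_eq r : 0 <= r <= 1 -> w r = w 1 +
  lam * (rint N (fun s => G (w s)) 1 - rint N (fun s => G (w s)) r).
Proof.
  intros Hr; assert (E := proj2 Hw); rewrite (E r Hr), (E 1) by lra; ring.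
Qed.

Lemma sol_0 : w 0 = d.
Proof. assert (E := proj2 Hw); rewrite (E 0), rint_0 by lra; ring. Qed.

Lemma sol_decr r r' : 0 <= r <= r' -> r' <= 1 -> w r' <= w r.
Proof.
  intros Hr Hr'; rewrite (sol_eq r), (sol_eq r') by lra.
  assert (A := rint_incr N (fun s => G (w s)) r r' HN CGw ltac:(lra)); nra.
Qed.

Lemma sol_le_datum r : 0 <= r <= 1 -> w r <= d.
Proof. intros Hr; rewrite <- sol_0; apply sol_decr; lra. Qed.

(** Concavity: the slope -w' increases, so the graph lies above its chord. Here [sg] is, up to the
    factor [lam], the slope at [r], which bounds the slopes on its left from above and those on its
    right from below. *)
Lemma sol_ge_linear r : 0 <= w 1 -> 0 <= r <= 1 -> d * (1 - r) <= w r.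
Proof.
  intros H1 Hr.
  assert (A := sol_eq r Hr); assert (B := sol_eq 0 ltac:(lra)).
  rewrite sol_0, rint_0 in B.
  set (q := rint N (fun s => G (w s))) in *.
  set (sg := root N (wint N (fun s => G (w s)) r)).
  assert (M : forall t t', 0 <= t <= t' -> root N (wint N (fun s => G (w s)) t) <=
    root N (wint N (fun s => G (w s)) t')).
  { intros t t' Ht; apply root_le; [exact HN | apply wint_incr; auto]. }
  assert (Q1 : sg * (1 - r) <= q 1 - q r).
  { apply rint_diff_ge; auto; [lra | intros; apply M; lra]. }
  assert (Q2 : q r - q 0 <= sg * (r - 0)).
  { apply rint_diff_le; auto; [lra | intros; apply M; lra]. }
  unfold q at 2 in Q2; rewrite rint_0 in Q2.
  assert (Q3 : (1 - r) * q 1 <= q 1 - q r) by nra.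
  assert (Q4 := Rmult_le_compat_l lam _ _ (Rlt_le _ _ Hlam) Q3).
  rewrite A, B; nra.
Qed.

End Solution.

(* If [w 1 <= 0], then [w <= c V] improves to [w <= theta c V] with the fixed ratio
   [theta = lam m / lam1 < 1], so iterating forces [w 0 <= 0]. *)
Lemma sol_end_pos : lam * phi < lam1 -> exists eta, 0 < eta /\
  forall G d w, cont G -> (forall s, 0 <= G s) -> (forall s, s <= 0 -> G s = 0) -> 0 < d ->
  (forall s, 0 <= s <= d -> Rabs (G s - phi ^ N * s ^ N) <= eta * d ^ N) ->
  radial_sol N G lam d w -> 0 < w 1.
Proof.
  intros Hlt.
  (* Any value strictly between [phi] and [lam1 / lam] would do: [phi < m] leaves room for the
     error, and [lam * m < lam1] gives [theta < 1]. *)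
  set (m := (phi + lam1 / lam) / 2).
  assert (Hq : phi < lam1 / lam).
  { apply Rmult_lt_reg_l with lam; [exact Hlam |].
    replace (lam * (lam1 / lam)) with lam1 by (field; lra); exact Hlt. }
  assert (Hm : phi < m < lam1 / lam) by (unfold m; lra).
  assert (Hlm : lam * m < lam1).
  { replace lam1 with (lam * (lam1 / lam)) by (field; lra); apply Rmult_lt_compat_l; lra. }
  assert (PV := eigen_pos (/ 2) ltac:(lra)); assert (PV0 := eigen_pos 0 ltac:(lra)).
  set (kappa := (V (/ 2) / 2) ^ N).
  assert (Hkappa : 0 < kappa) by (apply pow_lt; lra).
  assert (Hmp : 0 < m ^ N - phi ^ N).
  { assert (A := pow_lt_compat N phi m HN ltac:(lra)); lra. }
  (* Chosen so that the integrated error [eta * d ^ N * t ^ N] equals (m^N - phi^N) * (d / V 0)^N *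
     kappa * t^N, which is at most (m^N - phi^N) * c^N * wint(V^N) as soon as [c >= d / V 0]. *)
  set (eta := kappa * (m ^ N - phi ^ N) / V 0 ^ N).
  assert (Heta : 0 < eta).
  { apply Rdiv_lt_0_compat; [apply Rmult_lt_0_compat; assumption | apply pow_lt, PV0]. }
  exists eta; split; [exact Heta |].
  intros G d w HG G0 Gneg Hd HGd Hw; apply Rnot_le_lt; intros Hw1.
  assert (CGw : cont (fun s => G (w s))) by (apply cont_comp; [apply Hw | exact HG]).
  assert (HdN : 0 < d ^ N) by (apply pow_lt, Hd).
  assert (HphiN : 0 < phi ^ N) by (apply pow_lt, Hphi).
  set (E := fun c => forall r, 0 <= r <= 1 -> w r <= c * V r).
  (* Evaluation at 0. This lower bound converts an error relative to [d] into one relative to [c],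
     and finally contradicts the decay of [theta ^ n * c]. *)
  assert (Ec : forall c, E c -> d / V 0 <= c).
  { intros c H; specialize (H 0 ltac:(lra)); rewrite (sol_0 G d w Hw) in H.
    apply Rmult_le_reg_r with (V 0); [exact PV0 |].
    replace (d / V 0 * V 0) with d by (field; lra); exact H. }
  assert (E1 : exists c, E c).
  { destruct eigen_ge_linear as [k [Hk Vk]].
    set (B := (phi ^ N + eta) * d ^ N).
    assert (HB : 0 <= B) by (apply Rmult_le_pos; lra).
    exists (lam * root N B / k); intros r Hr.
    rewrite (sol_eq G d w Hw r Hr).
    apply Rle_trans with (lam * root N B * (1 - r)).
    - assert (A : rint N (fun s => G (w s)) 1 - rint N (fun s => G (w s)) r
        <= root N B * (1 - r)).
      { apply rint_diff_le; auto; [lra |]; intros t Ht.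
        apply root_wint_le; auto; [lra |]; intros s Hs.
        destruct (Rle_lt_dec (w s) 0) as [H | H]; [rewrite Gneg by exact H; exact HB |].
        assert (H' := sol_le_datum G d w HG Hw s Hs).
        assert (A := HGd (w s) ltac:(lra)); apply Rabs_le_between in A.
        assert (A' : w s ^ N <= d ^ N) by (apply pow_incr; lra).
        unfold B; nra. }
      nra.
    - replace (lam * root N B / k * V r) with (lam * root N B * (V r / k)) by (field; lra).
      apply Rmult_le_compat_l; [apply Rmult_le_pos; [lra | apply root_nonneg] |].
      apply Rmult_le_reg_l with k; [exact Hk |].
      replace (k * (V r / k)) with (V r) by (field; lra); apply Vk, Hr. }
  set (theta := lam * m / lam1).
  assert (Htheta : 0 <= theta < 1).
  { unfold theta; split.
    - apply Rdiv_le_0_compat; [apply Rmult_le_pos; lra | lra].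
    - apply Rmult_lt_reg_r with lam1; [exact Hlam1 |].
      replace (lam * m / lam1 * lam1) with (lam * m) by (field; lra); lra. }
  assert (step : forall c, E c -> E (theta * c)).
  { intros c Hc r Hr; assert (Hc0 := Ec c Hc).
    assert (Hdv : 0 < d / V 0) by (apply Rdiv_lt_0_compat; assumption).
    rewrite (sol_eq G d w Hw r Hr).
    assert (A : 1 * (rint N (fun s => G (w s)) 1 - rint N (fun s => G (w s)) r) <=
      (m * c) * (rint N (fun s => V s ^ N) 1 - rint N (fun s => V s ^ N) r)).
    { apply rint_diff_compare; auto; [lra |]; intros t Ht.
      assert (W0 : 0 <= wint N (fun s => V s ^ N) t).
      { apply wint_ge0; auto; [lra |]; intros s Hs; apply pow_le, eigen_ge0; lra. }
      rewrite Rmult_1_l, <- root_scal by (auto; apply Rmult_le_pos; lra).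
      apply root_le; [exact HN |].
      apply Rle_trans with (wint N (fun s => (phi * c) ^ N * V s ^ N + eta * d ^ N) t).
      - apply wint_le; auto; [| lra |].
        { apply cont_plus; [apply cont_mult; [apply cont_const | exact CVN] | apply cont_const]. }
        intros s Hs; assert (P := eigen_ge0 s ltac:(lra)).
        (* Near 1 the solution may be negative; the homogeneity estimate says nothing there, but [G]
           vanishes. *)
        destruct (Rle_lt_dec (w s) 0) as [H | H].
        + rewrite Gneg by exact H.
          assert (0 <= (phi * c) ^ N) by (apply pow_le, Rmult_le_pos; lra).
          assert (0 <= V s ^ N) by (apply pow_le, P).
          apply Rplus_le_le_0_compat; apply Rmult_le_pos; lra.
        + assert (H' := sol_le_datum G d w HG Hw s ltac:(lra)).
          assert (A := HGd (w s) ltac:(lra)); apply Rabs_le_between in A.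
          assert (A' : w s ^ N <= (c * V s) ^ N) by (apply pow_incr; split; [lra | apply Hc; lra]).
          rewrite Rpow_mult_distr in *; nra.
      - rewrite wint_affine by auto.
        set (W := wint N (fun s => V s ^ N) t) in *.
        assert (K := eigen_wint_ge t ltac:(lra)); fold kappa W in K.
        assert (EE : eta * d ^ N * t ^ N = (m ^ N - phi ^ N) * ((d / V 0) ^ N * (kappa * t ^ N))).
        { unfold eta, Rdiv; rewrite Rpow_mult_distr, pow_inv; ring. }
        assert (F : (d / V 0) ^ N * (kappa * t ^ N) <= c ^ N * W).
        { apply Rmult_le_compat.
          - apply pow_le; lra.
          - apply Rmult_le_pos; [lra | apply pow_le; lra].
          - apply pow_incr; lra.
          - exact K. }
        rewrite EE, !Rpow_mult_distr; nra. }
    rewrite Rmult_1_l in A.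
    assert (B := Rmult_le_compat_l lam _ _ (Rlt_le _ _ Hlam) A).
    rewrite (eigen_eq r Hr); unfold theta.
    replace (lam * m / lam1 * c * (lam1 * (rint N (fun s => V s ^ N) 1 - rint N (fun s => V s ^ N) r)))
      with (lam * (m * c * (rint N (fun s => V s ^ N) 1 - rint N (fun s => V s ^ N) r)))
      by (field; lra).
    lra. }
  destruct E1 as [c Hc].
  assert (iter : forall n, E (theta ^ n * c)).
  { induction n as [|n IH]; [simpl; rewrite Rmult_1_l; exact Hc |].
    simpl; rewrite Rmult_assoc; apply step, IH. }
  assert (Hdv : 0 < d / V 0) by (apply Rdiv_lt_0_compat; assumption).
  assert (Hc0 := Ec c Hc).
  destruct (pow_lt_1_zero theta) with (y := d / V 0 / c) as [n Hn].
  - rewrite Rabs_right; lra.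
  - apply Rdiv_lt_0_compat; lra.
  - specialize (Hn n (le_n n)); apply (Rle_lt_trans _ _ _ (Rle_abs _)) in Hn.
    assert (A := Ec _ (iter n)).
    apply (Rmult_lt_compat_r c) in Hn; [| lra].
    replace (d / V 0 / c * c) with (d / V 0) in Hn by (field; lra); lra.
Qed.

(* Dually, if [w 1 >= 0] then [w >= c V] improves to [w >= theta c V] with [theta > 1]. *)
Lemma sol_end_neg : lam1 < lam * phi -> exists eta, 0 < eta /\
  forall G d w, cont G -> (forall s, 0 <= G s) -> 0 < d ->
  (forall s, 0 <= s <= d -> Rabs (G s - phi ^ N * s ^ N) <= eta * d ^ N) ->
  radial_sol N G lam d w -> w 1 < 0.
Proof.
  intros Hlt.
  set (m := (phi + lam1 / lam) / 2).
  assert (Hq : lam1 / lam < phi).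
  { apply Rmult_lt_reg_l with lam; [exact Hlam |].
    replace (lam * (lam1 / lam)) with lam1 by (field; lra); exact Hlt. }
  assert (Hq0 : 0 < lam1 / lam) by (apply Rdiv_lt_0_compat; assumption).
  assert (Hm : lam1 / lam < m < phi) by (unfold m; lra).
  assert (Hlm : lam1 < lam * m).
  { replace lam1 with (lam * (lam1 / lam)) at 1 by (field; lra); apply Rmult_lt_compat_l; lra. }
  assert (PV := eigen_pos (/ 2) ltac:(lra)); assert (PV0 := eigen_pos 0 ltac:(lra)).
  set (kappa := (V (/ 2) / 2) ^ N).
  assert (Hkappa : 0 < kappa) by (apply pow_lt; lra).
  assert (Hmp : 0 < phi ^ N - m ^ N).
  { assert (A := pow_lt_compat N m phi HN ltac:(lra)); lra. }
  assert (Hlv : 0 < lam1 * V 0) by (apply Rmult_lt_0_compat; assumption).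
  (* Same balance as in the previous lemma, with the smallest constant now being the starting one,
     [d / (lam1 * V 0)], for which [c * V] lies below the chord [d * (1 - r)]. *)
  set (eta := kappa * (phi ^ N - m ^ N) / (lam1 * V 0) ^ N).
  assert (Heta : 0 < eta).
  { apply Rdiv_lt_0_compat; [apply Rmult_lt_0_compat; assumption | apply pow_lt, Hlv]. }
  exists eta; split; [exact Heta |].
  intros G d w HG G0 Hd HGd Hw; apply Rnot_le_lt; intros Hw1.
  assert (CGw : cont (fun s => G (w s))) by (apply cont_comp; [apply Hw | exact HG]).
  assert (HphiN : 0 < phi ^ N) by (apply pow_lt, Hphi).
  set (E := fun c => forall r, 0 <= r <= 1 -> c * V r <= w r).
  set (c0 := d / (lam1 * V 0)).
  assert (Hc0 : 0 < c0) by (apply Rdiv_lt_0_compat; assumption).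
  assert (E0 : E c0).
  { intros r Hr; apply Rle_trans with (2 := sol_ge_linear G d w HG G0 Hw r Hw1 Hr).
    assert (A := eigen_le_linear r Hr).
    apply Rle_trans with (c0 * (lam1 * V 0 * (1 - r))).
    - apply Rmult_le_compat_l; lra.
    - right; unfold c0; field; lra. }
  set (theta := lam * m / lam1).
  assert (Htheta : 1 < theta).
  { apply Rmult_lt_reg_r with lam1; [exact Hlam1 |]; unfold theta.
    replace (lam * m / lam1 * lam1) with (lam * m) by (field; lra); lra. }
  assert (step : forall c, c0 <= c -> E c -> E (theta * c)).
  { intros c Hc Ec r Hr.
    rewrite (sol_eq G d w Hw r Hr).
    assert (A : (m * c) * (rint N (fun s => V s ^ N) 1 - rint N (fun s => V s ^ N) r) <=
      1 * (rint N (fun s => G (w s)) 1 - rint N (fun s => G (w s)) r)).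
    { apply rint_diff_compare; auto; [lra |]; intros t Ht.
      assert (W0 : 0 <= wint N (fun s => V s ^ N) t).
      { apply wint_ge0; auto; [lra |]; intros s Hs; apply pow_le, eigen_ge0; lra. }
      rewrite Rmult_1_l, <- root_scal by (auto; apply Rmult_le_pos; lra).
      apply root_le; [exact HN |].
      apply Rle_trans with (wint N (fun s => (phi * c) ^ N * V s ^ N + - (eta * d ^ N)) t).
      - rewrite wint_affine by auto.
        set (W := wint N (fun s => V s ^ N) t) in *.
        assert (K := eigen_wint_ge t ltac:(lra)); fold kappa W in K.
        assert (EE : eta * d ^ N * t ^ N = (phi ^ N - m ^ N) * (c0 ^ N * (kappa * t ^ N))).
        { unfold c0, eta, Rdiv; rewrite (Rpow_mult_distr d), pow_inv; ring. }
        assert (F : c0 ^ N * (kappa * t ^ N) <= c ^ N * W).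
        { apply Rmult_le_compat.
          - apply pow_le; lra.
          - apply Rmult_le_pos; [lra | apply pow_le; lra].
          - apply pow_incr; lra.
          - exact K. }
        rewrite Ropp_mult_distr_l_reverse, EE, !Rpow_mult_distr; nra.
      - apply wint_le; auto; [| lra |].
        { apply cont_plus; [apply cont_mult; [apply cont_const | exact CVN] | apply cont_const]. }
        intros s Hs; assert (P := eigen_ge0 s ltac:(lra)).
        assert (P' : 0 <= c * V s) by (apply Rmult_le_pos; lra).
        assert (H := Ec s ltac:(lra)).
        assert (H' := sol_le_datum G d w HG Hw s ltac:(lra)).
        assert (A := HGd (w s) ltac:(lra)); apply Rabs_le_between in A.
        assert (A' : (c * V s) ^ N <= w s ^ N) by (apply pow_incr; lra).
        rewrite Rpow_mult_distr in *; nra. }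
    rewrite Rmult_1_l in A.
    assert (B := Rmult_le_compat_l lam _ _ (Rlt_le _ _ Hlam) A).
    rewrite (eigen_eq r Hr); unfold theta.
    replace (lam * m / lam1 * c * (lam1 * (rint N (fun s => V s ^ N) 1 - rint N (fun s => V s ^ N) r)))
      with (lam * (m * c * (rint N (fun s => V s ^ N) 1 - rint N (fun s => V s ^ N) r)))
      by (field; lra).
    lra. }
  (* The bound [c0 <= c] is carried along because the error is absorbed only for such [c]; it
     persists since [theta > 1]. At 0 the growing bounds exceed [w 0 = d]. *)
  assert (iter : forall n, c0 <= theta ^ n * c0 /\ E (theta ^ n * c0)).
  { induction n as [|n [IH1 IH2]]; [simpl; rewrite Rmult_1_l; split; [lra | exact E0] |].
    simpl; rewrite Rmult_assoc; split; [nra | apply step; assumption]. }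
  destruct (Pow_x_infinity theta) with (b := d / (c0 * V 0) + 1) as [n Hn].
  - rewrite Rabs_right; lra.
  - specialize (Hn n (le_n n)).
    assert (Pn : 0 < theta ^ n) by (apply pow_lt; lra).
    rewrite Rabs_right in Hn by lra.
    assert (A := proj2 (iter n) 0 ltac:(lra)); rewrite (sol_0 G d w Hw) in A.
    assert (Hcv : 0 < c0 * V 0) by (apply Rmult_lt_0_compat; assumption).
    assert (B : (d / (c0 * V 0) + 1) * (c0 * V 0) <= theta ^ n * (c0 * V 0))
      by (apply Rmult_le_compat_r; lra).
    replace ((d / (c0 * V 0) + 1) * (c0 * V 0)) with (d + c0 * V 0) in B by (field; lra).
    lra.
Qed.

End Comparison.

(** * Regularity *)

Lemma root_lt N x y : (1 <= N)%nat -> 0 <= x < y -> root N x < root N y.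
Proof.
  intros HN Hxy; apply Rnot_le_lt; intros H.
  assert (A : root N y ^ N <= root N x ^ N) by (apply pow_incr; split; [apply root_nonneg | exact H]).
  rewrite !root_pow in A by (auto; lra); lra.
Qed.

Lemma rint_incr_strict N h r r' : (1 <= N)%nat -> cont h -> r < r' ->
  (forall t, r < t < r' -> 0 < wint N h t) -> rint N h r < rint N h r'.
Proof.
  intros HN Hh Hr H; assert (E := rint_diff N h r r' HN Hh).
  assert (0 < RInt (fun t => root N (wint N h t)) r r'); [| lra].
  apply RInt_gt_0; [exact Hr | intros; apply root_gt0, H; assumption |].
  intros; apply root_wint_cont; assumption.
Qed.

Lemma cont_eps h x e : cont h -> 0 < e ->
  exists d, 0 < d /\ forall y, Rabs (y - x) < d -> Rabs (h y - h x) < e.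
Proof.
  intros H He.
  assert (A := proj1 (continuity_pt_locally h x) (cont_continuity h H x)).
  destruct (A (mkposreal e He)) as [d Hd]; exists d; split; [apply cond_pos |].
  intros y Hy; apply (Hd y Hy).
Qed.

Lemma cont_continuous_on h a b : cont h -> Defs.continuous_on h a b.
Proof.
  intros H x _ e He; destruct (cont_eps h x e H He) as [d [Hd H']].
  exists d; split; [exact Hd | intros y _; apply H'].
Qed.

(** Strict positivity at the single point 0 is enough, since continuity spreads it to an interval.
    For a solution, [h 0] is the nonlinearity at the datum. *)
Lemma wint_pos N h t : (1 <= N)%nat -> cont h -> 0 < t ->
  (forall s, 0 <= s <= t -> 0 <= h s) -> 0 < h 0 -> 0 < wint N h t.
Proof.
  intros HN Hh Ht H0 Hpos.
  destruct (cont_eps h 0 (h 0) Hh Hpos) as [d [Hd H]].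
  set (z := Rmin t (d / 2)).
  assert (Z1 : z <= t) by apply Rmin_l; assert (Z2 : z <= d / 2) by apply Rmin_r.
  assert (Z0 : 0 < z) by (apply Rmin_pos; lra).
  apply Rlt_le_trans with (wint N h z).
  - rewrite <- (wint_0 N h); apply wint_incr_strict; auto; [lra |].
    intros s Hs; assert (A : Rabs (s - 0) < d) by (rewrite Rabs_right; lra).
    apply H, Rabs_def2 in A; lra.
  - apply wint_incr; auto; lra.
Qed.

(** The mean of [h] over [0,t] for the weight N s^(N-1), completed at 0 by its limit. Writing the
    root of [wint] as [t] times the root of this mean isolates the zero at the origin, where the
    root itself is not differentiable if N > 1. *)
Definition wmean (N : nat) (h : R -> R) (t : R) : R :=
  if Req_EM_T t 0 then h 0 else wint N h t / t ^ N.

Lemma wmean_continuous_on N h : (1 <= N)%nat -> cont h ->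
  Defs.continuous_on (wmean N h) 0 1.
Proof.
  intros HN Hh x Hx e He; destruct (Req_dec x 0) as [-> | Hx0].
  - destruct (cont_eps h 0 (e / 2) Hh ltac:(lra)) as [d [Hd H]].
    exists d; split; [exact Hd |]; intros y Hy Hyd.
    unfold wmean; destruct (Req_EM_T 0 0) as [_ | ]; [| lra].
    destruct (Req_EM_T y 0) as [_ | Hy0]; [rewrite Rminus_diag, Rabs_R0; exact He |].
    rewrite Rminus_0_r, Rabs_right in Hyd by lra.
    assert (YN : 0 < y ^ N) by (apply pow_lt; lra).
    assert (B : forall s, 0 <= s <= y -> h 0 - e / 2 <= h s <= h 0 + e / 2).
    { intros s Hs; assert (A : Rabs (s - 0) < d) by (rewrite Rabs_right; lra).
      apply H, Rabs_def2 in A; lra. }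
    assert (U : wint N h y <= (h 0 + e / 2) * y ^ N).
    { rewrite <- wint_const by exact HN; apply wint_le; auto using cont_const; [lra | apply B]. }
    assert (L : (h 0 - e / 2) * y ^ N <= wint N h y).
    { rewrite <- wint_const by exact HN; apply wint_le; auto using cont_const; [lra | apply B]. }
    apply Rle_lt_trans with (e / 2); [| lra]; apply Rabs_le; split.
    + apply Rmult_le_reg_r with (y ^ N); [exact YN |].
      replace ((wint N h y / y ^ N - h 0) * y ^ N) with (wint N h y - h 0 * y ^ N) by (field; lra).
      lra.
    + apply Rmult_le_reg_r with (y ^ N); [exact YN |].
      replace ((wint N h y / y ^ N - h 0) * y ^ N) with (wint N h y - h 0 * y ^ N) by (field; lra).
      lra.
  - assert (XN : x ^ N <> 0) by (apply pow_nonzero, Hx0).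
    assert (C : continuity_pt (fun t => wint N h t / t ^ N) x).
    { apply continuity_pt_div; [apply cont_continuity, wint_cont, Hh | | exact XN].
      apply cont_continuity, cont_pow, cont_id. }
    rewrite continuity_pt_locally in C; destruct (C (mkposreal e He)) as [[d Hd] H].
    exists (Rmin d x); split; [apply Rmin_pos; lra |]; intros y Hy Hyd.
    assert (A1 : Rabs (y - x) < d) by (apply Rlt_le_trans with (1 := Hyd), Rmin_l).
    assert (A2 : Rabs (y - x) < x) by (apply Rlt_le_trans with (1 := Hyd), Rmin_r).
    apply Rabs_def2 in A2.
    unfold wmean; destruct (Req_EM_T y 0); [lra |]; destruct (Req_EM_T x 0); [lra |].
    apply (H y A1).
Qed.

Lemma strictly_concave_of_deriv u u1 :
  (forall x, 0 < x < 1 -> derivable_pt_lim u x (u1 x)) ->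
  (forall x y, 0 < x -> x < y -> y < 1 -> u1 y < u1 x) -> strictly_concave_01 u.
Proof.
  intros D M.
  assert (A : forall x y t, 0 < x < 1 -> 0 < y < 1 -> x < y -> 0 < t < 1 ->
    u (t * x + (1 - t) * y) > t * u x + (1 - t) * u y).
  { intros x y t Hx Hy Hxy Ht; set (z := t * x + (1 - t) * y).
    assert (Z1 : z - x = (1 - t) * (y - x)) by (unfold z; ring).
    assert (Z2 : y - z = t * (y - x)) by (unfold z; ring).
    assert (P1 : 0 < (1 - t) * (y - x)) by (apply Rmult_lt_0_compat; lra).
    assert (P2 : 0 < t * (y - x)) by (apply Rmult_lt_0_compat; lra).
    destruct (MVT_cor2 u u1 x z) as [c1 [E1 H1]]; [lra | intros; apply D; lra |].
    destruct (MVT_cor2 u u1 z y) as [c2 [E2 H2]]; [lra | intros; apply D; lra |].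
    assert (L := M c1 c2 ltac:(lra) ltac:(lra) ltac:(lra)).
    rewrite Z1 in E1; rewrite Z2 in E2.
    assert (Q : 0 < t * ((1 - t) * (y - x)) * (u1 c1 - u1 c2)).
    { apply Rmult_lt_0_compat; [apply Rmult_lt_0_compat |]; lra. }
    assert (F : u z - (t * u x + (1 - t) * u y) = t * (u z - u x) - (1 - t) * (u y - u z)) by ring.
    rewrite E1, E2 in F; lra. }
  intros x y t Hx Hy Hxy Ht; destruct (Rtotal_order x y) as [H | [H | H]]; [auto | lra |].
  assert (B := A y x (1 - t) Hy Hx H ltac:(lra)).
  replace ((1 - t) * y + (1 - (1 - t)) * x) with (t * x + (1 - t) * y) in B by ring.
  replace ((1 - t) * u y + (1 - (1 - t)) * u x) with (t * u x + (1 - t) * u y) in B by ring.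
  exact B.
Qed.

Lemma derivable_pt_lim_within g l x a b : derivable_pt_lim g x l ->
  forall e, 0 < e -> exists d, 0 < d /\
    forall y, a <= y <= b -> y <> x -> Rabs (y - x) < d ->
      Rabs ((g y - g x) / (y - x) - l) < e.
Proof.
  intros H e He; destruct (H e He) as [[d Hd] H'].
  exists d; split; [exact Hd |]; intros y _ Hyx Hy.
  replace (g y) with (g (x + (y - x))) by (f_equal; ring).
  apply H'; [lra | exact Hy].
Qed.

(** The derivative is -lam * r * b(r) with [b] continuous and positive, so it is differentiable at 0
    as well. The bound [u r <= d] is exported so that a truncation of [G] above [d] can be
    removed. *)
Lemma radial_sol_regular N G lam d w : (1 <= N)%nat -> 0 < lam -> cont G ->
  (forall s, 0 <= G s) -> (forall s, 0 < s <= d -> 0 < G s) -> 0 < d ->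
  radial_sol N G lam d w -> w 1 = 0 ->
  exists u u1 u2, C2_01 u u1 u2 /\
    (forall r, 0 < r < 1 -> derivable_pt_lim (fun x => (- u1 x) ^ N) r
       (lam ^ N * INR N * r ^ (N - 1) * G (u r))) /\
    u1 0 = 0 /\ u 1 = 0 /\ (forall r, 0 < r < 1 -> 0 < u r <= d) /\ strictly_concave_01 u.
Proof.
  intros HN Hlam HG G0 Gpos Hd Hw Hw1.
  set (h := fun s => G (w s)).
  assert (Ch : cont h) by exact (cont_comp w G (proj1 Hw) HG).
  assert (W0 := sol_0 N lam G d w Hw).
  assert (Eu := proj2 Hw); fold h in Eu.
  assert (h0 : 0 < h 0) by (unfold h; rewrite W0; apply Gpos; lra).
  assert (hge : forall s, 0 <= h s) by (intros; apply G0).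
  assert (Ipos : forall t, 0 < t -> 0 < wint N h t) by (intros; apply wint_pos; auto).
  assert (wpos : forall r, 0 <= r < 1 -> 0 < w r <= d).
  { intros r Hr; split.
    - rewrite (Eu r) by lra; rewrite (Eu 1) in Hw1 by lra.
      assert (A := rint_incr_strict N h r 1 HN Ch (proj2 Hr) (fun t Ht => Ipos t ltac:(lra))).
      assert (B := Rmult_lt_compat_l lam _ _ Hlam A); lra.
    - apply (sol_le_datum N HN lam Hlam G d w HG Hw); lra. }
  assert (hpos : forall r, 0 <= r < 1 -> 0 < h r) by (intros; apply Gpos, wpos; assumption).
  (* Equal to [w] on [0,1], but defined by the formula on the whole line and hence differentiable at
     the endpoints too; [w] is arbitrary outside. *)
  set (u := fun r => d - lam * rint N h r).
  set (u1 := fun r => - lam * root N (wint N h r)).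
  set (b := fun r => root N (wmean N h (clip 0 1 r))).
  (* In the chain rule N r^(N-1) h / (N (r b)^(N-1)) the powers of [r] cancel; what remains is
     continuous down to 0. *)
  set (u2 := fun r => - lam * (h r / b r ^ (N - 1))).
  assert (uw : forall r, 0 <= r <= 1 -> u r = w r) by (intros; symmetry; apply Eu; assumption).
  assert (bpos : forall r, 0 < b r).
  { intros r; apply root_gt0; unfold wmean; destruct (Req_EM_T (clip 0 1 r) 0); [exact h0 |].
    assert (A := clip_range 0 1 r ltac:(lra)).
    apply Rdiv_lt_0_compat; [apply Ipos | apply pow_lt]; lra. }
  assert (Cb : cont b).
  { apply (cont_comp (fun r => wmean N h (clip 0 1 r)) (root N)).
    - apply continuous_on_cont_clip; [lra | apply wmean_continuous_on; assumption].
    - intros x; apply root_continuous, HN. }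
  assert (Eb : forall r, 0 < r <= 1 -> root N (wint N h r) = r * b r).
  { intros r Hr; unfold b; rewrite clip_id by lra; unfold wmean.
    destruct (Req_EM_T r 0); [lra |].
    rewrite <- root_scal; [f_equal; field; apply pow_nonzero; lra | exact HN | lra |].
    left; apply Rdiv_lt_0_compat; [apply Ipos | apply pow_lt]; lra. }
  (* At 0 the difference quotient of [u1] tends to [- lam * b 0]; this identity, from b(0)^N = h(0),
     matches it with [u2 0]. *)
  assert (b0 : h 0 / b 0 ^ (N - 1) = b 0).
  { assert (A : b 0 ^ N = h 0).
    { unfold b, wmean; rewrite clip_id by lra; destruct (Req_EM_T 0 0); [| lra].
      apply root_pow; auto. }
    rewrite <- A; replace N with (S (N - 1)) at 1 by lia; simpl.
    field; apply pow_nonzero, Rgt_not_eq, bpos. }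
  assert (Du : forall x, derivable_pt_lim u x (u1 x)).
  { intros x; apply is_derive_Reals; unfold u, u1.
    replace (- lam * root N (wint N h x)) with (minus 0 (lam * root N (wint N h x)))
      by (unfold minus, plus, opp; simpl; ring).
    apply @is_derive_minus; [apply @is_derive_const | apply @is_derive_scal, rint_derive; assumption]. }
  assert (Du1 : forall x, 0 < x <= 1 -> derivable_pt_lim u1 x (u2 x)).
  { intros x Hx; apply is_derive_Reals; unfold u1, u2.
    apply @is_derive_scal.
    replace (h x / b x ^ (N - 1))
      with (scal (INR N * x ^ (N - 1) * h x) (/ (INR N * root N (wint N h x) ^ (N - 1)))).
    - apply (is_derive_comp (root N) (wint N h)); [apply root_derive; auto; apply Ipos; lra |].
      apply wint_derive, Ch.
    - unfold scal; simpl; unfold mult; simpl.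
      rewrite Eb by exact Hx; rewrite Rpow_mult_distr; field; repeat split.
      + apply pow_nonzero, Rgt_not_eq, bpos.
      + apply pow_nonzero; lra.
      + apply not_0_INR; lia. }
  exists u, u1, u2; split; [split; [| split] | split; [| split; [| split; [| split]]]].
  - intros x _; apply derivable_pt_lim_within, Du.
  - intros x Hx; destruct (Req_dec x 0) as [-> | Hx0].
    + intros e He; destruct (cont_eps b 0 (e / lam) Cb ltac:(apply Rdiv_lt_0_compat; lra))
        as [dl [Hdl H]].
      exists dl; split; [exact Hdl |]; intros y Hy Hy0 Hyd.
      unfold u1, u2; rewrite b0, wint_0, (root_npos N 0), Eb by lra.
      replace ((- lam * (y * b y) - - lam * 0) / (y - 0) - - lam * b 0)
        with (- lam * (b y - b 0)) by (field; lra).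
      rewrite Rabs_mult, Rabs_Ropp, (Rabs_right lam) by lra.
      replace e with (lam * (e / lam)) by (field; lra).
      apply Rmult_lt_compat_l; [exact Hlam | apply H, Hyd].
    + apply derivable_pt_lim_within, Du1; lra.
  - apply cont_continuous_on; unfold u2.
    apply cont_mult; [apply cont_const |]; intros x.
    apply continuity_pt_filterlim, continuity_pt_div.
    + apply cont_continuity, Ch.
    + apply cont_continuity, cont_pow, Cb.
    + apply pow_nonzero, Rgt_not_eq, bpos.
  - intros r Hr; apply is_derive_Reals.
    rewrite uw by lra.
    apply is_derive_ext_loc with (fun x => lam ^ N * wint N h x).
    + assert (Hr0 : 0 < r) by lra; exists (mkposreal r Hr0); intros y Hy; simpl in Hy.
      apply Rabs_def2 in Hy; unfold minus, plus, opp in Hy; simpl in Hy.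
      unfold u1; replace (- (- lam * root N (wint N h y))) with (lam * root N (wint N h y)) by ring.
      rewrite Rpow_mult_distr, root_pow; auto; left; apply Ipos; lra.
    + replace (lam ^ N * INR N * r ^ (N - 1) * G (w r))
        with (lam ^ N * (INR N * r ^ (N - 1) * h r)) by (unfold h; ring).
      apply @is_derive_scal, wint_derive, Ch.
  - unfold u1; rewrite wint_0, root_npos by lra; ring.
  - rewrite uw by lra; exact Hw1.
  - intros r Hr; rewrite uw by lra; apply wpos; lra.
  - apply strictly_concave_of_deriv with u1; [intros; apply Du |].
    intros x y Hx Hxy Hy; unfold u1.
    assert (A : root N (wint N h x) < root N (wint N h y)).
    { apply root_lt; [exact HN |]; split; [left; apply Ipos, Hx |].
      apply wint_incr_strict; auto; [lra | intros; apply hpos; lra]. }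
    nra.
Qed.

(** * Existence *)

Lemma clip_comp_unif_cont g b : 0 <= b -> continuity g -> unif_cont (fun s => g (clip 0 b s)).
Proof.
  intros Hb Hg e He.
  destruct (Heine g (fun c => 0 <= c <= b) (compact_P3 0 b) (fun x _ => Hg x) (mkposreal e He))
    as [[d Hd] H]; simpl in H.
  exists (d / 2); split; [lra |]; intros x y Hxy; left.
  apply H; try apply clip_range, Hb.
  apply Rle_lt_trans with (1 := clip_lipschitz 0 b x y); lra.
Qed.

Section PositiveSolution.

Context (N : nat) (g : R -> R) (f0 finf : R).
Context (HN : (1 <= N)%nat) (Hg : continuity g) (gpos : forall s, 0 < s -> 0 < g s).
Context (Hf0 : forall eps, 0 < eps -> exists delta, 0 < delta /\
  forall s, 0 < s < delta -> Rabs (g s / s ^ N - f0 ^ N) < eps).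
Context (Hfinf : forall eps, 0 < eps -> exists M, 0 < M /\
  forall s, M < s -> Rabs (g s / s ^ N - finf ^ N) < eps).

Lemma abs_diff_of_quotient phi eta s : 0 < s -> Rabs (g s / s ^ N - phi ^ N) < eta ->
  Rabs (g s - phi ^ N * s ^ N) <= eta * s ^ N.
Proof.
  intros Hs H; assert (P : 0 < s ^ N) by (apply pow_lt, Hs).
  replace (g s - phi ^ N * s ^ N) with ((g s / s ^ N - phi ^ N) * s ^ N) by (field; lra).
  rewrite Rabs_mult, (Rabs_right (s ^ N)) by lra; apply Rmult_le_compat_r; lra.
Qed.

(** A finite quotient limit makes g(s) = O(s^N) as s decreases to 0, and N >= 1. Hence clipping at 0
    extends [g] by zero to negative arguments. *)
Lemma g_at_0 : g 0 = 0.
Proof.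
  apply cond_eq; intros e He; rewrite Rminus_0_r.
  assert (A := proj1 (continuity_pt_locally g 0) (Hg 0)).
  destruct (A (mkposreal (e / 2) ltac:(lra))) as [[d1 Hd1] H1]; simpl in H1.
  destruct (Hf0 1 ltac:(lra)) as [d2 [Hd2 H2]].
  set (C := Rabs (f0 ^ N) + 1).
  assert (HC : 0 < C) by (unfold C; assert (P := Rabs_pos (f0 ^ N)); lra).
  assert (HeC : 0 < e / 2 / C) by (apply Rdiv_lt_0_compat; lra).
  (* One point [s] serves all purposes: within the continuity and quotient ranges, at most 1 so that
     [s ^ N <= s], and with [C * s <= e / 2]. *)
  set (s := Rmin (Rmin (d1 / 2) (d2 / 2)) (Rmin 1 (e / 2 / C))).
  assert (S1 : s <= d1 / 2) by (unfold s; eapply Rle_trans; [apply Rmin_l | apply Rmin_l]).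
  assert (S2 : s <= d2 / 2) by (unfold s; eapply Rle_trans; [apply Rmin_l | apply Rmin_r]).
  assert (S3 : s <= 1) by (unfold s; eapply Rle_trans; [apply Rmin_r | apply Rmin_l]).
  assert (S4 : s <= e / 2 / C) by (unfold s; eapply Rle_trans; [apply Rmin_r | apply Rmin_r]).
  assert (S0 : 0 < s) by (unfold s; repeat apply Rmin_pos; lra).
  assert (B := abs_diff_of_quotient f0 1 s S0 (H2 s ltac:(lra))).
  assert (sN : s ^ N <= s).
  { replace N with (S (N - 1)) by lia; simpl.
    assert (s ^ (N - 1) <= 1 ^ (N - 1)) by (apply pow_incr; lra); rewrite pow1 in *; nra. }
  assert (sN0 : 0 < s ^ N) by (apply pow_lt, S0).
  assert (D : Rabs (s - 0) < d1) by (rewrite Rminus_0_r, Rabs_right; lra).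
  specialize (H1 s D); apply Rabs_def2 in H1; apply Rabs_le_between in B.
  assert (F := Rle_abs (f0 ^ N)); assert (F' := Rle_abs (- f0 ^ N)); rewrite Rabs_Ropp in F'.
  assert (I : C * s <= e / 2).
  { replace (e / 2) with (C * (e / 2 / C)) by (field; lra); apply Rmult_le_compat_l; lra. }
  assert (I' : C * s ^ N <= C * s) by (apply Rmult_le_compat_l; lra).
  assert (J1 : f0 ^ N * s ^ N <= Rabs (f0 ^ N) * s ^ N) by (apply Rmult_le_compat_r; lra).
  assert (J2 : - f0 ^ N * s ^ N <= Rabs (f0 ^ N) * s ^ N) by (apply Rmult_le_compat_r; lra).
  unfold C in *; apply Rabs_def1; lra.
Qed.

Lemma almost_homog_small eta : 0 < eta -> exists delta, 0 < delta /\
  forall d, d <= delta ->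
  forall s, 0 <= s <= d -> Rabs (g s - f0 ^ N * s ^ N) <= eta * d ^ N.
Proof.
  intros Heta; destruct (Hf0 eta Heta) as [dl [Hdl H]].
  exists (dl / 2); split; [lra |]; intros d Hd s Hs.
  assert (SN : s ^ N <= d ^ N) by (apply pow_incr; lra).
  assert (SN0 : 0 <= s ^ N) by (apply pow_le; lra).
  destruct (Req_dec s 0) as [-> | Hs0].
  - rewrite g_at_0, pow_i, Rmult_0_r, Rminus_diag, Rabs_R0 by lia.
    rewrite pow_i in SN by lia; apply Rmult_le_pos; lra.
  - apply Rle_trans with (eta * s ^ N); [| apply Rmult_le_compat_l; lra].
    apply abs_diff_of_quotient; [| apply H]; lra.
Qed.

(** For [s] beyond [M] the quotient limit applies. Up to [M] the error is bounded by a constant [K],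
    which [eta * d ^ N] dominates once [d >= 1] and [d >= K / eta]. *)
Lemma almost_homog_large eta : 0 < eta -> exists D, 0 < D /\
  forall d, D <= d ->
  forall s, 0 <= s <= d -> Rabs (g s - finf ^ N * s ^ N) <= eta * d ^ N.
Proof.
  intros Heta; destruct (Hfinf eta Heta) as [M [HM H]].
  destruct (continuity_ab_maj (fun s => Rabs (g s - finf ^ N * s ^ N)) 0 M) as [z [Hz _]];
    [lra | |].
  { intros c _; apply (continuity_pt_comp (fun s => g s - finf ^ N * s ^ N) Rabs);
      [| apply Rcontinuity_abs].
    apply continuity_pt_minus; [apply Hg |].
    apply cont_continuity, cont_mult; [apply cont_const | apply cont_pow, cont_id]. }
  set (K := Rabs (g z - finf ^ N * z ^ N)) in *.
  exists (Rmax 1 (K / eta)); split; [apply Rlt_le_trans with 1; [lra | apply Rmax_l] |].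
  intros d Hd s Hs.
  assert (D1 : 1 <= d) by (apply Rle_trans with (2 := Hd), Rmax_l).
  assert (D2 : K / eta <= d) by (apply Rle_trans with (2 := Hd), Rmax_r).
  assert (SN : s ^ N <= d ^ N) by (apply pow_incr; lra).
  destruct (Rle_lt_dec s M) as [HsM | HsM].
  - apply Rle_trans with K; [apply Hz; lra |].
    assert (dN : d <= d ^ N).
    { replace N with (S (N - 1)) by lia; simpl.
      assert (1 <= d ^ (N - 1)) by (apply pow_R1_Rle; exact D1); nra. }
    replace K with (eta * (K / eta)) by (field; lra); apply Rmult_le_compat_l; lra.
  - apply Rle_trans with (eta * s ^ N); [| apply Rmult_le_compat_l; lra].
    apply abs_diff_of_quotient; [lra | apply H, HsM].
Qed.

Lemma positive_solution lam1 lam : 0 < f0 -> 0 < finf -> 0 < lam1 ->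
  (exists v, pos_eigenfunction N lam1 v) ->
  ((lam1 / finf < lam < lam1 / f0) \/ (lam1 / f0 < lam < lam1 / finf)) ->
  exists u u1 u2, C2_01 u u1 u2 /\
    (forall r, 0 < r < 1 -> derivable_pt_lim (fun x => (- u1 x) ^ N) r
       (lam ^ N * INR N * r ^ (N - 1) * g (u r))) /\
    u1 0 = 0 /\ u 1 = 0 /\ (forall r, 0 < r < 1 -> 0 < u r) /\ strictly_concave_01 u.
Proof.
  intros F0 Finf Hl1 [v Hv] Hcase.
  destruct (pos_eigenfunction_radial N lam1 v HN Hl1 Hv) as [V HV].
  assert (P0 : 0 < lam1 / f0) by (apply Rdiv_lt_0_compat; assumption).
  assert (Pinf : 0 < lam1 / finf) by (apply Rdiv_lt_0_compat; assumption).
  assert (Hlam : 0 < lam) by (destruct Hcase; lra).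
  assert (small : forall phi, 0 < phi -> lam < lam1 / phi -> lam * phi < lam1).
  { intros phi Hphi H; apply (Rmult_lt_compat_r phi) in H; [| exact Hphi].
    replace (lam1 / phi * phi) with lam1 in H by (field; lra); exact H. }
  assert (large : forall phi, 0 < phi -> lam1 / phi < lam -> lam1 < lam * phi).
  { intros phi Hphi H; apply (Rmult_lt_compat_r phi) in H; [| exact Hphi].
    replace (lam1 / phi * phi) with lam1 in H by (field; lra); exact H. }
  (* Truncation at the larger shooting datum [b]: below 0 it vanishes, above [b] it is constant, and
     on [0,d] with [d <= b] it agrees with [g]. *)
  set (G := fun b s => g (clip 0 b s)).
  assert (gge : forall s, 0 <= s -> 0 <= g s).
  { intros s Hs; destruct (Req_dec s 0) as [-> | H]; [rewrite g_at_0; lra | left; apply gpos; lra]. }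
  assert (G0 : forall b s, 0 <= b -> 0 <= G b s) by (intros; apply gge, clip_range; assumption).
  assert (Gneg : forall b s, 0 <= b -> s <= 0 -> G b s = 0).
  { intros b s Hb Hs; unfold G; replace (clip 0 b s) with 0; [apply g_at_0 |].
    unfold clip, Rmax, Rmin; repeat destruct Rle_dec; lra. }
  assert (Gunif : forall b, 0 <= b -> unif_cont (G b))
    by (intros; apply clip_comp_unif_cont; assumption).
  assert (Shoot : exists b sg a, 0 < a <= b /\
    (forall w, radial_sol N (G b) lam a w -> 0 < sg * w 1) /\
    (forall w, radial_sol N (G b) lam b w -> sg * w 1 < 0)).
  { assert (Near : forall a b phi eta, 0 < a <= b ->
      (forall s, 0 <= s <= a -> Rabs (g s - phi ^ N * s ^ N) <= eta * a ^ N) ->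
      forall s, 0 <= s <= a -> Rabs (G b s - phi ^ N * s ^ N) <= eta * a ^ N).
    { intros a b phi eta Hab H s Hs; unfold G; rewrite clip_id by lra; apply H, Hs. }
    destruct Hcase as [[C1 C2] | [C1 C2]].
    - destruct (sol_end_pos N lam1 V HN Hl1 HV lam f0 Hlam F0 (small f0 F0 C2)) as [e1 [He1 H1]].
      destruct (sol_end_neg N lam1 V HN Hl1 HV lam finf Hlam Finf (large finf Finf C1)) as [e2 [He2 H2]].
      destruct (almost_homog_small e1 He1) as [a [Ha Qa]].
      destruct (almost_homog_large e2 He2) as [D [HD QD]].
      assert (M1 := Rmax_l a D); assert (M2 := Rmax_r a D).
      set (b := Rmax a D) in *; assert (Ub := unif_cont_cont _ (Gunif b ltac:(lra))).
      exists b, 1, a; split; [lra |]; split; intros w Hw; rewrite Rmult_1_l.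
      + apply (H1 (G b) a w); auto; [intros; apply G0; lra | intros; apply Gneg; lra |].
        apply Near; [lra | apply Qa; lra].
      + apply (H2 (G b) b w); auto; [intros; apply G0; lra | lra |].
        apply Near; [lra | apply QD; lra].
    - destruct (sol_end_neg N lam1 V HN Hl1 HV lam f0 Hlam F0 (large f0 F0 C1)) as [e1 [He1 H1]].
      destruct (sol_end_pos N lam1 V HN Hl1 HV lam finf Hlam Finf (small finf Finf C2)) as [e2 [He2 H2]].
      destruct (almost_homog_small e1 He1) as [a [Ha Qa]].
      destruct (almost_homog_large e2 He2) as [D [HD QD]].
      assert (M1 := Rmax_l a D); assert (M2 := Rmax_r a D).
      set (b := Rmax a D) in *; assert (Ub := unif_cont_cont _ (Gunif b ltac:(lra))).
      (* Here [lam] is above [lam1 / f0], so small data end below zero and large data above: the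
         sign change is reversed. *)
      exists b, (-1), a; split; [lra |]; split; intros w Hw.
      + assert (w 1 < 0); [| lra].
        apply (H1 (G b) a w); auto; [intros; apply G0; lra |].
        apply Near; [lra | apply Qa; lra].
      + assert (0 < w 1); [| lra].
        apply (H2 (G b) b w); auto; [intros; apply G0; lra | intros; apply Gneg; lra | lra |].
        apply Near; [lra | apply QD; lra]. }
  destruct Shoot as [b [sg [a [Hab [Sa Sb]]]]].
  destruct (continuity_ab_maj g 0 b ltac:(lra) (fun c _ => Hg c)) as [z [Hz _]].
  assert (HK : forall s, 0 <= G b s <= g z).
  { intros s; split; [apply G0; lra | apply Hz, clip_range; lra]. }
  destruct (shooting N (G b) lam (g z) HN ltac:(lra) (Gunif b ltac:(lra)) HK sg a b ltac:(lra) Sa Sb)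
    as [d [w [Hd [Hw Hw1]]]].
  destruct (radial_sol_regular N (G b) lam d w HN Hlam (unif_cont_cont _ (Gunif b ltac:(lra))))
    as [u [u1 [u2 [R1 [R2 [R3 [R4 [R5 R6]]]]]]]]; auto.
  { intros; apply G0; lra. }
  { intros s Hs; unfold G; rewrite clip_id by lra; apply gpos; lra. }
  { lra. }
  exists u, u1, u2; repeat split; try apply R1; auto.
  - intros r Hr; assert (B := R5 r Hr).
    replace (g (u r)) with (G b (u r)); [apply R2, Hr |].
    unfold G; rewrite clip_id by lra; reflexivity.
  - intros r Hr; apply R5, Hr.
Qed.

End PositiveSolution.

(** A positive solution [u] feels [f] on negative arguments: in terms of -u' the nonlinearity is
    g(s) = (-1)^N f(-s), and g(s) / s^N = f(-s) / (-s)^N has the same limits. A negative solution -w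
    feels [f] on positive arguments, with g = f. In both cases (f1) makes g positive for s > 0. *)
Theorem theorem4p1 (N : nat) (f : R -> R) (f0 finf lam1 lam : R) :
  (1 <= N)%nat ->
  cond_f1 N f ->
  0 < f0 -> is_f0 N f f0 ->
  0 < finf -> is_finf N f finf ->
  first_eigenvalue N lam1 ->
  ((lam1 / finf < lam < lam1 / f0) \/ (lam1 / f0 < lam < lam1 / finf)) ->
  exists up um : R -> R,
    solves_MO N f lam up /\ solves_MO N f lam um /\
    (forall r, 0 < r < 1 -> 0 < up r) /\ strictly_concave_01 up /\
    (forall r, 0 < r < 1 -> um r < 0) /\ strictly_convex_01 um.
Proof.
  intros HN [Hf fsign] F0 Hf0 Finf Hfinf [Hl1 [Hv _]] Hcase.
  assert (sq : (-1) ^ N * (-1) ^ N = 1)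
    by (rewrite <- Rpow_mult_distr; replace (-1 * -1) with 1 by ring; apply pow1).
  assert (oppN : forall s, (- s) ^ N = (-1) ^ N * s ^ N)
    by (intros s; rewrite <- Rpow_mult_distr; f_equal; ring).
  assert (quot : forall s, 0 < s -> (-1) ^ N * f (- s) / s ^ N = f (- s) / (- s) ^ N).
  { intros s Hs; rewrite oppN; assert (P : s ^ N <> 0) by (apply pow_nonzero; lra).
    assert (Q : (-1) ^ N <> 0) by (apply pow_nonzero; lra).
    apply Rmult_eq_reg_l with ((-1) ^ N); [| exact Q].
    replace ((-1) ^ N * ((-1) ^ N * f (- s) / s ^ N))
      with (((-1) ^ N * (-1) ^ N) * (f (- s) / s ^ N)) by (field; exact P).
    rewrite sq; field; split; assumption. }
  destruct (positive_solution N (fun s => (-1) ^ N * f (- s)) f0 finf HN)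
    with (lam1 := lam1) (lam := lam)
    as [u [u1 [u2 [U1 [U2 [U3 [U4 [U5 U6]]]]]]]]; auto.
  { intros x; apply continuity_pt_mult; [apply continuity_pt_const; intros ? ?; reflexivity |].
    apply (continuity_pt_comp Ropp f); [| apply Hf].
    apply continuity_pt_opp, derivable_continuous_pt, derivable_pt_id. }
  { intros s Hs; assert (A := fsign (- s) ltac:(lra)); rewrite oppN in A.
    assert (P : 0 < s ^ N) by (apply pow_lt, Hs).
    apply Rmult_lt_reg_r with (s ^ N); [exact P | lra]. }
  { intros e He; destruct (Hf0 e He) as [dl [Hdl H]]; exists dl; split; [exact Hdl |].
    intros s Hs; rewrite quot by lra; apply H; [lra |]; rewrite Rabs_Ropp, Rabs_right; lra. }
  { intros e He; destruct (Hfinf e He) as [M [HM H]]; exists M; split; [exact HM |].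
    intros s Hs; rewrite quot by lra; apply H; rewrite Rabs_Ropp, Rabs_right; lra. }
  destruct (positive_solution N f f0 finf HN Hf) with (lam1 := lam1) (lam := lam)
    as [w [w1 [w2 [[W1 [W1' W1'']] [W2 [W3 [W4 [W5 W6]]]]]]]]; auto.
  { intros s Hs; assert (A := fsign s ltac:(lra)).
    assert (P : 0 < s ^ N) by (apply pow_lt, Hs).
    apply Rmult_lt_reg_r with (s ^ N); [exact P | lra]. }
  { intros e He; destruct (Hf0 e He) as [dl [Hdl H]]; exists dl; split; [exact Hdl |].
    intros s Hs; apply H; [lra |]; rewrite Rabs_right; lra. }
  { intros e He; destruct (Hfinf e He) as [M [HM H]]; exists M; split; [exact HM |].
    intros s Hs; apply H; rewrite Rabs_right; lra. }
  assert (derivN : forall p p', has_deriv_on p p' 0 1 ->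
    has_deriv_on (fun x => - p x) (fun x => - p' x) 0 1).
  { intros p p' H x Hx e He; destruct (H x Hx e He) as [dl [Hdl H']].
    exists dl; split; [exact Hdl |]; intros y Hy Hyx Hyd; specialize (H' y Hy Hyx Hyd).
    replace ((- p y - - p x) / (y - x) - - p' x)
      with (- ((p y - p x) / (y - x) - p' x)) by (field; lra).
    rewrite Rabs_Ropp; exact H'. }
  exists u, (fun x => - w x).
  split; [| split; [| split; [exact U5 | split; [exact U6 | split]]]].
  - exists u1, u2; split; [exact U1 | split; [| auto]]; intros r Hr.
    apply is_derive_Reals.
    apply is_derive_ext with (fun x => (-1) ^ N * (- u1 x) ^ N).
    { intros x; rewrite <- Rpow_mult_distr; f_equal; ring. }
    replace (lam ^ N * INR N * r ^ (N - 1) * f (- u r))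
      with ((-1) ^ N * (lam ^ N * INR N * r ^ (N - 1) * ((-1) ^ N * f (- u r)))).
    + apply @is_derive_scal, is_derive_Reals, U2, Hr.
    + transitivity (((-1) ^ N * (-1) ^ N) * (lam ^ N * INR N * r ^ (N - 1) * f (- u r)));
        [ring | rewrite sq; ring].
  - exists (fun x => - w1 x), (fun x => - w2 x).
    split; [split; [| split] | split; [| split]].
    + apply derivN, W1.
    + apply derivN, W1'.
    + intros x Hx e He; destruct (W1'' x Hx e He) as [dl [Hdl H]].
      exists dl; split; [exact Hdl |]; intros y Hy Hyd.
      replace (- w2 y - - w2 x) with (- (w2 y - w2 x)) by ring.
      rewrite Rabs_Ropp; apply H; assumption.
    + intros r Hr; rewrite Ropp_involutive; apply W2, Hr.
    + rewrite W3; ring.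
    + rewrite W4; ring.
  - intros r Hr; assert (A := W5 r Hr); lra.
  - intros x y t Hx Hy Hxy Ht; assert (A := W6 x y t Hx Hy Hxy Ht); lra.
Qed.
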